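(* For topologically mixing maps in the class $\mathcal{CPMM}^{pc}$, the existence of a nonnegative eigenvector of the transition matrix with eigenvalue $\lambda$ is necessary but not sufficient for conjugacy to a map of constant slope $\lambda$. That is: (a) (Necessity) Let $f\in\mathcal{CPMM}^{pc}$ be topologically mixing, with partition set $P$ and transition matrix $T=T(f,P)$, and let $\lambda>1$. If $f$ is conjugate via a homeomorphism $\psi$ to some map $g\in\mathcal{CPMM}^{pc}$ of constant slope $\lambda$, then $T$ has a nonnegative eigenvector $v=(v_I)\in\mathbb{R}^{\mathcal{B}(P)}$ with eigenvalue $\lambda$. (b) (Non-sufficiency) There exist a topologically mixing map $f\in\mathcal{CPMM}^{pc}$ with a partition set $P$ and a number $\lambda>1$ such that the transition matrix $T(f,P)$ has a nonnegative eigenvector $v\in\mathbb{R}^{\mathcal{B}(P)}$ with eigenvalue $\lambda$, but $f$ is not conjugate via any homeomorphism to any map $g\in\mathcal{CPMM}^{pc}$ of constant slope $\lambda$.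
   Context: The extended real line $[-\infty,\infty]=\mathbb{R}\cup\{-\infty,\infty\}$ carries the order topology. Class $\mathcal{CPMM}^{pc}$: a (not necessarily continuous) self-map $f:[a,b]\to[a,b]$ of an interval with $-\infty\le a<b\le\infty$ belongs to $\mathcal{CPMM}^{pc}$ with partition set $P$ if $P\subset[a,b]$ is a closed countable set with $a,b\in P$ such that: $f(P)\subset P$; for each connected component $I$ of $[a,b]\setminus P$ the restriction $f|_I$ is continuous and strictly monotone; and for any two components $I,J$ of $[a,b]\setminus P$, either $f(I)\cap J=\emptyset$ or $f(I)\supseteq J$. No continuity is required at points of $P$. The components of $[a,b]\setminus P$ are called $P$-basic intervals and $\mathcal{B}(P)$ is the set of all of them. Constant slope: a map in $\mathcal{CPMM}^{pc}$ with partition set $P$ has constant slope $\lambda$ if its restriction to each $P$-basic interval is affine with slope of absolute value $\lambda$. (For $g$, this is with respect to a partition set of $g$.) Transition matrix: $T=T(f,P)$ has rows and columns indexed by $\mathcal{B}(P)$, with $T(I,J)=1$ if $f(I)\supseteq J$ and $T(I,J)=0$ otherwise. A nonnegative eigenvector of $T$ with eigenvalue $\lambda$ is a nonzero $v=(v_I)_{I\in\mathcal{B}(P)}$ with real entries $v_I\ge 0$ such that $\sum_{J\in\mathcal{B}(P)}T(I,J)v_J=\lambda v_I$ (in particular the sum converges) for every $I\in\mathcal{B}(P)$. Conjugate via $\psi$: $f:[a,b]\to[a,b]$ is conjugate to $g:[c,d]\to[c,d]$ via $\psi$ if $\psi:[a,b]\to[c,d]$ is a homeomorphism with $\psi\circ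 f=g\circ\psi$; here $[c,d]$ may be any interval with $-\infty\le c<d\le\infty$. Topologically mixing: for every pair of nonempty open sets $U,V$ there exists $n_0\in\mathbb{N}$ such that $f^n(U)\cap V\neq\emptyset$ for all $n\ge n_0$. *)

(* Defs.v *)
From HB Require Import structures.
From mathcomp Require Import all_boot all_order all_algebra.
From mathcomp Require Import all_classical all_reals all_analysis.

Set Implicit Arguments.
Unset Strict Implicit.
Unset Printing Implicit Defensive.

Import Order.TTheory GRing.Theory Num.Theory.
Import numFieldNormedType.Exports.

Local Open Scope classical_set_scope.
Local Open Scope ring_scope.

(* A self-map of [a, b] is encoded as a total function on \bar R that maps
   [a, b] into itself; its values outside [a, b] are never inspected. *)

Section cpmm.
Context {R : realType}.
Implicit Types (a b c d : \bar R) (P I J : set (\bar R)).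
Implicit Types (f g psi : \bar R -> \bar R) (lambda : R).

Definition basic_intervals a b P : set (set (\bar R)) :=
  [set connected_component (`[a, b] `\` P) x | x in `[a, b] `\` P].

Definition strictly_monotone_on I f : Prop :=
  {in I &, {homo f : x y / (x < y)%E}} \/
  {in I &, {homo f : x y /~ (x < y)%E}}.

Record cpmm_pc a b P f : Prop := CpmmPc {
  cpmm_lt : (a < b)%E ;
  cpmm_self : f @` `[a, b] `<=` `[a, b] ;
  cpmm_sub : P `<=` `[a, b] ;
  cpmm_closed : closed P ;
  cpmm_countable : countable P ;
  cpmm_left : P a ;
  cpmm_right : P b ;
  cpmm_invariant : f @` P `<=` P ;
  cpmm_continuous : forall I, basic_intervals a b P I ->
    {within I, continuous f} ;
  cpmm_monotone : forall I, basic_intervals a b P I ->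
    strictly_monotone_on I f ;
  cpmm_markov : forall I J, basic_intervals a b P I ->
    basic_intervals a b P J ->
    (f @` I) `&` J = set0 \/ J `<=` f @` I }.

(* Basic intervals contain only finite points, because a, b \in P, so no
   indeterminate extended-real operation occurs below. *)
Definition constant_slope a b P f lambda : Prop :=
  forall I, basic_intervals a b P I ->
    exists s t : R, `|s| = lambda /\
      forall x, I x -> f x = (s%:E * x + t%:E)%E.

(* The nonempty relatively open subsets of [a, b] are the nonempty traces on
   [a, b] of the open subsets of \bar R. *)
Definition topologically_mixing a b f : Prop :=
  forall U V : set (\bar R), open U -> open V ->
    U `&` `[a, b] !=set0 -> V `&` `[a, b] !=set0 ->
    exists n0 : nat, forall n : nat, (n0 <= n)%N ->
      (iter n f @` (U `&` `[a, b])) `&` (V `&` `[a, b]) !=set0.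

Definition transition_matrix f I J : R := (`[< J `<=` f @` I >])%:R.

(* Only the coordinates v I with I a basic interval are relevant. As all terms
   are nonnegative, the unordered sum \esum always exists in [0, +oo], and its
   equality with a finite number expresses convergence. *)
Definition nonneg_eigenvector a b P f lambda (v : set (\bar R) -> R) : Prop :=
  [/\ forall I, basic_intervals a b P I -> 0 <= v I,
      exists2 I, basic_intervals a b P I & v I != 0 &
      forall I, basic_intervals a b P I ->
        \esum_(J in basic_intervals a b P) (transition_matrix f I J * v J)%:E
        = (lambda * v I)%:E].

Definition homeomorphism_on (A B : set (\bar R)) psi : Prop :=
  exists phi : \bar R -> \bar R,
    [/\ psi @` A `<=` B, phi @` B `<=` A,
        {in A, cancel psi phi}, {in B, cancel phi psi} &
        {within A, continuous psi} /\ {within B, continuous phi}].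

Definition conjugate_via a b c d f g psi : Prop :=
  homeomorphism_on `[a, b] `[c, d] psi /\
  forall x, `[a, b]%classic x -> psi (f x) = g (psi x).

Definition conjugate_to_constant_slope a b f lambda : Prop :=
  exists c d Q g psi,
    [/\ cpmm_pc c d Q g, constant_slope c d Q g lambda &
        conjugate_via a b c d f g psi].

End cpmm.

(* Main.v *)
(* Necessity.  Write psi for the conjugacy and let I be a basic interval of f.
   On I the function psi o f - s psi, for s = lambda or - lambda according to the
   direction in which f is monotone on I, is locally constant off a countable
   set, so its image is a countable interval, i.e. a point: psi o f is an affine
   function of psi with slope s on I.  The lengths of the sets psi(I) then form
   the eigenvector, provided these sets are bounded; an unbounded one would let
   orbits escape to infinity, since |s y + t| > |y| for |y| large, against mixing.

   Non-sufficiency.  On [-1, 1] take the partition set { 1/m : m integer } with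
   1/0 = 0.  In the coordinate u = 1/x, the map sends (m, m + 1) affinely onto
   (m - 1, m + 2), except that (1, 2) goes to (- 4, - 1) and (- 2, - 1) to (1, 4).
   The constant vector is an eigenvector for 3.  If the map were conjugate to a
   map of constant slope 3, then the lengths v_m of the images of the pieces
   would satisfy v_(m-1) + v_m + v_(m+1) = 3 v_m for m large, so they would form
   a positive arithmetic progression, which is not summable; but the pieces
   accumulate at the interior point 0, whose image is finite. *)

From HB Require Import structures.
Require Import Defs.
From mathcomp Require Import all_boot all_order all_algebra.
From mathcomp Require Import all_classical all_reals all_analysis.
From mathcomp Require Import measurable_realfun lra zify.

Set Implicit Arguments.
Unset Strict Implicit.
Unset Printing Implicit Defensive.

Import Order.TTheory GRing.Theory Num.Theory.
Import numFieldNormedType.Exports.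

Local Open Scope classical_set_scope.
Local Open Scope ring_scope.

(** * Basic intervals *)

Section basic_intervals_theory.
Context {R : realType}.
Implicit Types (a b : \bar R) (P I J : set (\bar R)).

(** If [z] were missing from [C], the traces of [w < z] and [w <= z] on [C] would coincide. This
    trace would be clopen in [C] and contain [x], hence be all of [C], although [y] is not in it. *)
Lemma connected_ereal_convex (C : set (\bar R)) (x y z : \bar R) :
  connected C -> C x -> C y -> (x <= z <= y)%E -> C z.
Proof.
move=> Cc Cx Cy /andP[xz zy]; apply: contrapT => nCz.
have nz w : C w -> w != z by move=> Cw; apply/eqP => wz; apply: nCz; rewrite -wz.
have E : C `&` [set w | (w < z)%E] = C.
  apply: Cc.
  - by exists x; split => //=; rewrite lt_neqAle nz.
  - by exists [set w | (w < z)%E] => //; exact: open_ereal_lt_ereal.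
  - exists [set w | (w <= z)%E]; first exact: closed_ereal_ge_ereal.
    by apply/seteqP; split => w [Cw] /= => [/ltW|wz]; rewrite ?lt_neqAle ?nz.
by move: Cy; rewrite -E => -[_ /=]; rewrite ltNge zy.
Qed.

Lemma connected_EFin (A : set R) : is_interval A -> connected (EFin @` A).
Proof.
move=> /connected_intervalP cA; apply: connected_continuous_connected => //.
by apply: continuous_subspaceT => x; apply: cvg_EFin; [exact: nearW|].
Qed.

Section gap.
Variables (a b : \bar R) (P : set (\bar R)).
Hypotheses (Pcl : closed P) (Pa : P a) (Pb : P b).

Lemma basic_mem x : (a <= x <= b)%E -> ~ P x ->
  exists2 I, basic_intervals a b P I & I x.
Proof.
move=> axb Px; have D : (`[a, b] `\` P) x by split => //=; rewrite in_itv.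
by exists (connected_component (`[a, b] `\` P) x); [exists x|exact: connected_component_refl].
Qed.

Lemma basic_sub I x : basic_intervals a b P I -> I x ->
  (a < x < b)%E /\ ~ P x.
Proof.
move=> [y _ <-] /connected_component_sub[/= + Px]; rewrite in_itv/= => /andP[ax xb].
split=> //; rewrite !lt_neqAle ax xb !andbT; apply/andP.
by split; apply/eqP => E; apply: Px; rewrite -?E// E.
Qed.

Lemma basic_fin I x : basic_intervals a b P I -> I x -> x = (fine x)%:E.
Proof.
move=> bI /(basic_sub bI)[/andP[ax xb] _]; rewrite fineK//.
by rewrite fin_real// (le_lt_trans _ ax) ?leNye// (lt_le_trans xb)// leey.
Qed.

Lemma basic_convex I x y z : basic_intervals a b P I -> I x -> I y ->
  (x <= z <= y)%E -> I z.
Proof. by move=> [w _ <-]; apply: connected_ereal_convex; exact: component_connected. Qed.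

Lemma basic_eq I J x : basic_intervals a b P I -> basic_intervals a b P J ->
  I x -> J x -> I = J.
Proof.
by move=> [y _ <-] [z _ <-] /same_connected_component -> /same_connected_component ->.
Qed.

Lemma basic_connected_sub I (C : set (\bar R)) x : basic_intervals a b P I ->
  connected C -> C `<=` `[a, b] `\` P -> C x -> I x -> C `<=` I.
Proof.
move=> [y _ <-] Cc CD Cx /same_connected_component ->.
exact: connected_component_max.
Qed.

(** As [P] is closed and contains [a] and [b], a point of [I] has a ball inside []a, b[] that misses
    [P]. The ball is connected, so it stays in the component. *)
Lemma basic_open I : basic_intervals a b P I -> open I.
Proof.
move=> bI; rewrite openE => x Ix; rewrite /interior.
have [/andP[ax xb] Px] := basic_sub bI Ix.
move: ax xb Px; rewrite (basic_fin bI Ix); set r := fine x => ax xb Px.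
have : \forall y \near r%:E, [/\ (a < y)%E, (y < b)%E & ~ P y].
  near=> y; split; near: y.
  - by apply: open_nbhs_nbhs; split => //; exact: open_ereal_gt_ereal.
  - by apply: open_nbhs_nbhs; split => //; exact: open_ereal_lt_ereal.
  - by apply: open_nbhs_nbhs; split => //; exact: closed_openC.
move=> /nbhs_EFin/nbhs_ballP[e /= e0 re].
suff h y : ball r e y -> I y%:E.
  by apply/nbhs_EFin/nbhs_ballP; exists e => // y /h.
move=> rey; apply: (@basic_connected_sub _ (EFin @` ball r e) r%:E) => //.
- apply: connected_EFin; rewrite ball_itv; exact: interval_is_interval.
- by move=> _ [z /re[az zb Pz] <-]; split => //=; rewrite in_itv/= !ltW.
- by exists r => //; exact: ballxx.
- by rewrite -(basic_fin bI Ix).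
Unshelve. all: by end_near. Qed.

Lemma basic_nonempty I : basic_intervals a b P I -> exists x : R, I x%:E.
Proof.
move=> bI; have [y Dy Iy] := bI.
have Iyy : I y by rewrite -Iy; exact: connected_component_refl.
by exists (fine y); rewrite -(basic_fin bI Iyy).
Qed.

(** Nothing is lost for basic intervals, whose points are all finite, and lengths become Lebesgue
    measures of sets of reals. *)
Definition rpart (I : set (\bar R)) : set R := EFin @^-1` I.

Lemma basic_is_interval I : basic_intervals a b P I -> is_interval (rpart I).
Proof.
by move=> bI x y Ix Iy z xzy; apply: (basic_convex bI Ix Iy); rewrite !lee_fin.
Qed.

Lemma basic_near I x : basic_intervals a b P I -> I x%:E ->
  \forall y \near x, I y%:E.
Proof.
move=> bI Ix.
have : nbhs x%:E I by apply: open_nbhs_nbhs; split => //; exact: basic_open.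
by move=> /nbhs_EFin.
Qed.

Lemma basic_segment I x y : basic_intervals a b P I -> I x%:E ->
  (a <= y%:E <= b)%E ->
  (forall z, Num.min x y <= z <= Num.max x y -> ~ P z%:E) -> I y%:E.
Proof.
move=> bI Ix /andP[ay yb] hP; have [/andP[/ltW ax /ltW xb] _] := basic_sub bI Ix.
apply: (@basic_connected_sub _ (EFin @` `[Num.min x y, Num.max x y]) x%:E) => //.
- exact/connected_EFin/interval_is_interval.
- move=> _ [z /= + <-]; rewrite in_itv/= => zxy; split; last exact: hP.
  move: zxy; rewrite in_itv/= ge_min le_max => /andP[/orP h1 /orP h2]; apply/andP; split.
    by case: h1 => h; [apply: le_trans ax _|apply: le_trans ay _]; rewrite lee_fin.
  by case: h2 => h; [apply: le_trans _ xb|apply: le_trans _ yb]; rewrite lee_fin.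
- by exists x; rewrite //= in_itv/= ge_min le_max !lexx.
- by exists y; rewrite //= in_itv/= ge_min le_max !lexx !orbT.
Qed.

(** Serves to recognise the basic intervals of a concrete partition: segments inside the gap miss
    [P], while a component can pass neither [p] nor [q]. *)
Lemma basic_gap p q : P p -> P q -> (a <= p)%E -> (q <= b)%E -> p \is a fin_num ->
  q \is a fin_num -> (p < q)%E ->
  (forall z, (p < z < q)%E -> ~ P z) -> basic_intervals a b P `]p, q[%classic.
Proof.
move=> Pp Pq ap qb pf qf pq hP.
have [r] : exists r : R, (p < r%:E < q)%E.
  move: pf qf pq; case: p q {Pp Pq ap qb hP} => [p||] [q||]//= _ _.
  by rewrite lte_fin => pq; exists ((p + q) / 2); rewrite !lte_fin; lra.
move=> /[dup] prq /andP[pr rq].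
have arb : (a <= r%:E <= b)%E.
  by rewrite (le_trans ap (ltW pr)) (le_trans (ltW rq) qb).
have [I bI Ir] := basic_mem arb (hP _ prq).
suff -> : `]p, q[%classic = I by [].
apply/seteqP; split => [z|z Iz] /=; rewrite in_itv/=.
  move=> /[dup] pzq /andP[pz zq].
  have zf : z \is a fin_num.
    by rewrite fin_real// (le_lt_trans _ pz) ?leNye// (lt_le_trans zq)// leey.
  move: zf pz zq pzq; case: z => // z _ pz zq pzq.
  apply: (basic_segment bI Ir).
    by rewrite (le_trans ap (ltW pz)) (le_trans (ltW zq) qb).
  move=> w; rewrite ge_min le_max => /andP[/orP h1 /orP h2]; apply: hP.
  apply/andP; split.
    by case: h1 => h; [apply: lt_le_trans pr _|apply: lt_le_trans pz _]; rewrite lee_fin.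
  by case: h2 => h; [apply: le_lt_trans _ rq|apply: le_lt_trans _ zq]; rewrite lee_fin.
have [azb Pz] := basic_sub bI Iz.
rewrite !ltNge; apply/andP; split; apply/negP => h.
  have /(basic_sub bI)[_] : I p by apply: (basic_convex bI Iz Ir); rewrite h ltW.
  exact.
have /(basic_sub bI)[_] : I q by apply: (basic_convex bI Ir Iz); rewrite h ltW.
exact.
Qed.

End gap.
End basic_intervals_theory.

(** * Homeomorphisms of extended intervals and Markov maps *)

Section maps.
Context {R : realType}.
Implicit Types (a b c d : \bar R) (P I J : set (\bar R)) (f g psi : \bar R -> \bar R).

Lemma itv_of_ereal a b : (a < b)%E ->
  exists i : interval R, forall r, (r \in i) = (a < r%:E < b)%E.
Proof.
case: a b => [a||] [b||]// _.
- by exists `]a, b[ => r; rewrite in_itv/= !lte_fin.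
- by exists `]a, +oo[ => r; rewrite in_itv/= lte_fin ltry.
- by exists `]-oo, b[ => r; rewrite in_itv/= lte_fin ltNyr.
- by exists `]-oo, +oo[ => r; rewrite in_itv/= ltry ltNyr.
Qed.

(** Balls of [\bar R] are defined through [contract]. Composing with it makes a homeomorphism
    real-valued before its values are known to be finite. *)
Lemma contract_continuous : continuous (@contract R).
Proof.
move=> x; apply/cvgrPdist_lt => e e0.
by apply: filterS (nbhsx_ballx x _ e0) => y.
Qed.

Lemma near_between a b (r : R) : (a < r%:E < b)%E ->
  \forall y \near r, (a < y%:E < b)%E.
Proof.
move=> /andP[ar rb]; near=> y; apply/andP; split; near: y.
  by apply: open_nbhs_nbhs; split => //; exact: open_ereal_gt.
by apply: open_nbhs_nbhs; split => //; exact: open_ereal_lt.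
Unshelve. all: by end_near. Qed.

Lemma within_itv_continuous_at a b psi (r : R) :
  {within `[a, b], continuous psi} -> (a < r%:E < b)%E ->
  {for r%:E, continuous psi}.
Proof.
move=> ct arb.
have ct' : {within `]a, b[%classic, continuous psi}.
  apply: continuous_subspaceW ct => x /=; rewrite !in_itv/= => /andP[/ltW -> /ltW ->//].
have op : open (`]a, b[%classic : set (\bar R)).
  rewrite (_ : `]a, b[%classic = [set x | (a < x)%E] `&` [set x | (x < b)%E]).
    by apply: openI; [exact: open_ereal_gt_ereal|exact: open_ereal_lt_ereal].
  by apply/seteqP; split => x /=; rewrite in_itv/= => /andP.
have h := continuous_open_subspace psi op.
by rewrite h in ct'; apply: ct'; rewrite inE/= in_itv.
Qed.

Lemma between_lt a b (x y : R) : (a < x%:E)%E -> (y%:E < b)%E -> x < y ->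
  (a < x%:E < b)%E /\ (a < y%:E < b)%E.
Proof.
move=> ax yb xy; rewrite ax yb/= andbT; split.
  by apply: lt_trans yb; rewrite lte_fin.
by apply: lt_trans ax _; rewrite lte_fin.
Qed.

Section homeo.
Variables (a b c d : \bar R) (psi : \bar R -> \bar R).
Hypotheses (ab : (a < b)%E) (hpsi : homeomorphism_on `[a, b] `[c, d] psi).

Lemma homeo_inj x y : (a <= x <= b)%E -> (a <= y <= b)%E -> psi x = psi y -> x = y.
Proof.
have [phi [_ _ psiK _ _]] := hpsi.
by move=> hx hy e; rewrite -(psiK x) ?inE//= e psiK// inE.
Qed.

Lemma homeo_in x : (a <= x <= b)%E -> (c <= psi x <= d)%E.
Proof.
have [phi [+ _ _ _ _]] := hpsi => h hx.
by have := h (psi x); rewrite /= in_itv/=; apply; exists x => //; rewrite in_itv.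
Qed.

Lemma homeo_ct (r : R) : (a < r%:E < b)%E -> {for r%:E, continuous psi}.
Proof.
have [phi [_ _ _ _ [+ _]]] := hpsi; exact: within_itv_continuous_at.
Qed.

Lemma ltW_between x : (a < x < b)%E -> (a <= x <= b)%E.
Proof. by move=> /andP[/ltW -> /ltW ->]. Qed.

Lemma homeo_EFin_continuous (r : R) : (a < r%:E < b)%E ->
  {for r, continuous (psi \o EFin)}.
Proof.
move=> arb; apply: continuous_comp; last exact: homeo_ct.
by apply: cvg_EFin; [exact: nearW|].
Qed.

(** The composite of [contract], [psi] and [EFin] is a continuous injection on a real interval,
    hence strictly monotone, and [contract] reflects the order. *)
Lemma homeo_contract_mono :
  (forall x y : R, (a < x%:E)%E -> (y%:E < b)%E -> x < y -> (psi x%:E < psi y%:E)%E) \/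
  (forall x y : R, (a < x%:E)%E -> (y%:E < b)%E -> x < y -> (psi y%:E < psi x%:E)%E).
Proof.
have [i iP] := itv_of_ereal ab.
have ct : {within [set` i], continuous (@contract R \o (psi \o EFin))}.
  apply: continuous_in_subspaceT => r; rewrite inE/= iP => arb.
  apply: continuous_comp; first exact: homeo_EFin_continuous.
  exact: contract_continuous.
have inj : {in i &, injective (@contract R \o (psi \o EFin))}.
  move=> x y; rewrite !iP => hx hy /contract_inj.
  by move/homeo_inj => h; apply: EFin_inj; apply: h; exact: ltW_between.
have [m|m] := itv_continuous_inj_mono ct inj; [left|right] => x y ax yb xy;
  have [hx hy] := between_lt ax yb xy;
  by rewrite -lt_contract; apply: m => //; rewrite iP.
Qed.

Lemma between_fin x : (a < x < b)%E -> x = (fine x)%:E.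
Proof.
move=> /andP[ax xb]; rewrite fineK//.
by rewrite fin_real// (le_lt_trans _ ax) ?leNye// (lt_le_trans xb)// leey.
Qed.

(** Points of []a, b[] on both sides of [x] have values in [[c, d]], and strict monotonicity puts
    [psi x] strictly between these values. *)
Lemma homeo_inside x : (a < x < b)%E -> (c < psi x < d)%E.
Proof.
move=> /[dup] axb; rewrite (between_fin axb); set r := fine x => arb.
have /nbhs_ballP[e /= e0 re] := near_between arb.
have [r1 h1 hr1] : exists2 r1, r1 < r & (a < r1%:E < b)%E.
  exists (r - e / 2); first by lra.
  by apply: re; rewrite /ball/= opprB addrC subrK gtr0_norm; lra.
have [r2 h2 hr2] : exists2 r2, r < r2 & (a < r2%:E < b)%E.
  exists (r + e / 2); first by lra.
  by apply: re; rewrite /ball/= opprD addrA subrr sub0r normrN gtr0_norm; lra.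
have /andP[ar1 r1b] := hr1; have /andP[ar2 r2b] := hr2; have /andP[ar rb] := arb.
have /andP[c1 d1] := homeo_in (ltW_between hr1).
have /andP[c2 d2] := homeo_in (ltW_between hr2).
have [m|m] := homeo_contract_mono; apply/andP; split.
- by apply: le_lt_trans (m _ _ ar1 rb h1).
- by apply: lt_le_trans (m _ _ ar r2b h2) _.
- by apply: le_lt_trans (m _ _ ar r2b h2).
- by apply: lt_le_trans (m _ _ ar1 rb h1) _.
Qed.

End homeo.

Lemma fine_between c d x : (c < x < d)%E -> (fine x)%:E = x :> \bar R.
Proof. by move=> h; rewrite -(between_fin h). Qed.

Section homeo_real.
Variables (a b c d : \bar R) (psi : \bar R -> \bar R).
Hypotheses (ab : (a < b)%E) (hpsi : homeomorphism_on `[a, b] `[c, d] psi).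

(** The default value of [fine] does not intervene on []a, b[], where [homeo_inside] makes [psi]
    finite. *)
Definition real_map (r : R) : R := fine (psi r%:E).

Lemma real_mapE r : (a < r%:E < b)%E -> (real_map r)%:E = psi r%:E.
Proof. by move=> arb; rewrite /real_map (fine_between (homeo_inside ab hpsi arb)). Qed.

Lemma real_map_continuous (r : R) : (a < r%:E < b)%E -> {for r, continuous real_map}.
Proof.
move=> arb; have ct := @homeo_EFin_continuous _ _ _ _ _ hpsi r arb.
rewrite /prop_for/continuous_at; apply: fine_cvg.
by rewrite real_mapE.
Qed.

Lemma real_map_mono :
  (forall x y : R, (a < x%:E)%E -> (y%:E < b)%E -> x < y -> real_map x < real_map y) \/
  (forall x y : R, (a < x%:E)%E -> (y%:E < b)%E -> x < y -> real_map y < real_map x).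
Proof.
by have [m|m] := homeo_contract_mono ab hpsi; [left|right] => x y ax yb xy;
  have [hx hy] := between_lt ax yb xy; rewrite -lte_fin !real_mapE//; apply: m.
Qed.
End homeo_real.

Section cpmm_facts.
Variables (a b : \bar R) (P : set (\bar R)) (f : \bar R -> \bar R).
Hypothesis (cf : cpmm_pc a b P f).
Let Pcl := cpmm_closed cf.
Let Pa := cpmm_left cf.
Let Pb := cpmm_right cf.

(** The open set [I] contains points on both sides of [x], and [f] is strictly monotone there, so
    [f x] is not extreme in [[a, b]]. *)
Lemma cpmm_image_inside I x : basic_intervals a b P I -> I x -> (a < f x < b)%E.
Proof.
move=> bI Ix; have xE := basic_fin Pa Pb bI Ix; move: Ix; rewrite xE.
move: (fine x) => {xE}r {x} Ir.
have /nbhs_ballP[e /= e0 re] := basic_near Pcl Pa Pb bI Ir.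
have I1 : I (r - e/2)%:E.
  by apply: re; rewrite /ball/= opprB addrC subrK gtr0_norm; lra.
have I2 : I (r + e/2)%:E.
  by apply: re; rewrite /ball/= opprD addrA subrr sub0r normrN gtr0_norm; lra.
have self y : I y -> (a <= f y <= b)%E.
  move=> Iy; have [aPb _] := basic_sub Pa Pb bI Iy.
  have := @cpmm_self _ _ _ _ _ cf (f y); rewrite /= in_itv/=; apply.
  by exists y => //; rewrite in_itv/= ltW_between.
have /andP[a1 b1] := self _ I1; have /andP[a2 b2] := self _ I2.
have h1 : ((r - e/2)%:E < r%:E)%E by rewrite lte_fin; lra.
have h2 : (r%:E < (r + e/2)%:E)%E by rewrite lte_fin; lra.
have [m|m] := cpmm_monotone cf bI; apply/andP; split.
- by apply: le_lt_trans a1 _; apply: m; rewrite ?inE.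
- by apply: lt_le_trans b2; apply: m; rewrite ?inE.
- by apply: le_lt_trans a2 _; apply: m; rewrite ?inE.
- by apply: lt_le_trans b1; apply: m; rewrite ?inE.
Qed.

Lemma cpmm_cover I J x : basic_intervals a b P I -> basic_intervals a b P J ->
  I x -> J (f x) -> J `<=` f @` I.
Proof.
move=> bI bJ Ix Jfx; have [E|//] := cpmm_markov cf bI bJ.
by suff : (@set0 (\bar R)) (f x) by []; rewrite -E; split => //; exists x.
Qed.

Lemma iter_self n x : (a <= x <= b)%E -> (a <= iter n f x <= b)%E.
Proof.
move=> axb; elim: n => //= n IH.
have := @cpmm_self _ _ _ _ _ cf (f (iter n f x)); rewrite /= in_itv/=; apply.
by exists (iter n f x) => //; rewrite in_itv.
Qed.

(** Mixing returns some point of [I] to [I] after [n0.+1] steps. One step before the return the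
    orbit is outside the invariant set [P], and the basic interval it then visits covers [I] by the
    Markov property. *)
Lemma mixing_covered I : topologically_mixing a b f -> basic_intervals a b P I ->
  exists2 J, basic_intervals a b P J & I `<=` f @` J.
Proof.
move=> mix bI.
have [x0 Ix0] := basic_nonempty Pa Pb bI.
have Iab : I `<=` `[a, b].
  by move=> x /(basic_sub Pa Pb bI)[axb _]; rewrite /= in_itv/= ltW_between.
have op := basic_open Pcl Pa Pb bI.
have [||n0 /(_ n0.+1 (leqnSn _))] := mix I I op op.
- by exists x0%:E; split => //; exact: Iab.
- by exists x0%:E; split => //; exact: Iab.
move=> [y [[x [Ix xab] /= fxy] [Iy _]]].
move: xab; rewrite /= in_itv/= => xab.
have zab := iter_self n0 xab; set z := iter n0 f x in fxy zab.
have Pz : ~ P z.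
  move=> Pz; have [_] := basic_sub Pa Pb bI Iy; apply.
  by apply: (cpmm_invariant cf); exists z.
have [J bJ Jz] := basic_mem zab Pz.
by exists J => //; apply: (cpmm_cover bJ bI Jz); rewrite fxy.
Qed.

End cpmm_facts.
End maps.

(** * Maps conjugate to a map of constant slope are affine in the conjugated coordinate *)

Section countable_image.
Context {R : realType}.

Lemma itv_not_countable (x y : R) : x < y -> ~ countable (`]x, y[%classic : set R).
Proof.
move=> xy /countable_lebesgue_measure0; rewrite lebesgue_measure_itv/= lte_fin xy.
by rewrite -EFinB => -[]/eqP; rewrite subr_eq0 gt_eqF.
Qed.

(** The image is an interval, and an interval with two distinct points is uncountable. *)
Lemma continuous_countable_image_const (A : set R) (K : R -> R) :
  is_interval A -> {in A, continuous K} -> countable (K @` A) ->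
  forall x y, A x -> A y -> K x = K y.
Proof.
move=> iA ct cK.
have iK : is_interval (K @` A).
  apply/connected_intervalP; apply: connected_continuous_connected.
    exact/connected_intervalP.
  exact: continuous_in_subspaceT.
suff h x y : A x -> A y -> ~~ (K x < K y).
  move=> x y Ax Ay; apply/eqP; rewrite eq_le !leNgt.
  by rewrite (h x y)// (h y x).
move=> Ax Ay; apply/negP => xy; apply: (itv_not_countable xy).
apply: sub_countable cK; apply: subset_card_le => z /=; rewrite in_itv/= => /andP[z1 z2].
by apply: (iK (K x) (K y)); [exists x|exists y|rewrite !ltW].
Qed.
End countable_image.

Section conjugacy.
Context {R : realType}.
Variables (a b c d : \bar R) (P Q : set (\bar R)) (f g psi : \bar R -> \bar R).
Variable (lambda : R).
Hypotheses (cf : cpmm_pc a b P f) (cg : cpmm_pc c d Q g).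
Hypotheses (slope : constant_slope c d Q g lambda) (lam0 : 0 < lambda).
Hypothesis (conj : conjugate_via a b c d f g psi).
Let ab := cpmm_lt cf.
Let hpsi := conj.1.
Local Notation Psi := (real_map psi).

Lemma conj_affine I : basic_intervals a b P I ->
  exists s t : R, `|s| = lambda /\
    forall x : R, I x%:E -> Psi (fine (f x%:E)) = s * Psi x + t.
Proof.
move=> bI.
have Pa := cpmm_left cf; have Pb := cpmm_right cf; have Pcl := cpmm_closed cf.
have Qc := cpmm_left cg; have Qd := cpmm_right cg; have Qcl := cpmm_closed cg.
pose A := rpart I; pose F x := fine (f x%:E).
have Aab x : A x -> (a < x%:E < b)%E by move=> /(basic_sub Pa Pb bI)[].
have Fab x : A x -> (a < f x%:E < b)%E by move=> /(cpmm_image_inside cf bI).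
have FE x : A x -> (F x)%:E = f x%:E by move=> /Fab /fine_between.
have Pmono := real_map_mono ab hpsi.
(* The sign of [s0] records whether [f] preserves or reverses the order on [I]. The direction of
   [Psi] enters both factors of the product and cancels. *)
have [s0 s0lam s0P] : exists2 s, s = lambda \/ s = - lambda &
    forall x y, A x -> A y -> x < y ->
      0 < s * ((Psi y - Psi x) * (Psi (F y) - Psi (F x))).
  have Pm x y : (a < x%:E)%E -> (y%:E < b)%E -> x < y -> (a < (F x)%:E)%E -> ((F y)%:E < b)%E ->
     F x < F y -> 0 < (Psi y - Psi x) * (Psi (F y) - Psi (F x)).
    move=> ax yb xy aFx Fyb Fxy.
    case: Pmono => m; have := m _ _ ax yb xy; have := m _ _ aFx Fyb Fxy; nra.
  have Pm' x y : (a < x%:E)%E -> (y%:E < b)%E -> x < y -> (a < (F y)%:E)%E -> ((F x)%:E < b)%E ->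
     F y < F x -> (Psi y - Psi x) * (Psi (F y) - Psi (F x)) < 0.
    move=> ax yb xy aFx Fyb Fxy.
    case: Pmono => m; have := m _ _ ax yb xy; have := m _ _ aFx Fyb Fxy; nra.
  have [m|m] := cpmm_monotone cf bI; [exists lambda|exists (- lambda)];
    [by left| |by right|]; move=> x y Ax Ay xy.
    have /andP[ax _] := Aab _ Ax; have /andP[_ yb] := Aab _ Ay.
    have /andP[aFx _] := Fab _ Ax; have /andP[_ Fyb] := Fab _ Ay.
    apply: mulr_gt0 => //; apply: Pm => //; rewrite ?FE//.
    by rewrite -lte_fin !FE//; apply: m; rewrite ?inE ?lte_fin.
  have /andP[ax _] := Aab _ Ax; have /andP[_ yb] := Aab _ Ay.
  have /andP[aFy _] := Fab _ Ay; have /andP[_ Fxb] := Fab _ Ax.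
  rewrite mulNr oppr_gt0 pmulr_rlt0//; apply: Pm' => //; rewrite ?FE//.
  by rewrite -lte_fin !FE//; apply: m; rewrite ?inE ?lte_fin.
pose K x := Psi (F x) - s0 * Psi x.
have gPsi x : A x -> g (psi x%:E) = (Psi (F x))%:E.
  move=> Ax; rewrite -conj.2 /= ?in_itv/= ?ltW_between ?Aab// -FE// (real_mapE ab hpsi)// FE//.
  exact: Fab.
have Kct : {in A, continuous K}.
  move=> x; rewrite inE => Ax; apply: cvgB; last first.
    by apply: cvgMr; apply: (real_map_continuous ab hpsi); exact: Aab.
  have op := basic_open Pcl Pa Pb bI.
  have fc : {for x%:E, continuous f}.
    have := cpmm_continuous cf bI; rewrite continuous_open_subspace//; apply.
    by rewrite inE.
  have Fc : F @ x --> F x.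
    apply: fine_cvg; rewrite FE//.
  have Pc : {for F x, continuous Psi}.
    by apply: (real_map_continuous ab hpsi); rewrite FE//; exact: Fab.
  by apply: continuous_cvg; [exact: Pc|exact: Fc].
(* Countably many sample points on which [K] takes all its values: where [psi x] is not in [Q], the
   function [K] is locally constant, so a nearby rational gives the same value. *)
pose C := [set x | A x /\ (@rational R x \/ Q (psi x%:E))].
have KC : K @` A `<=` K @` C.
  move=> _ [x Ax <-]; have [Qx|Qx] := pselect (Q (psi x%:E)).
    by exists x => //; split => //; right.
  have psix := homeo_inside ab hpsi (Aab _ Ax).
  have [J bJ Jx] := basic_mem (ltW_between psix) Qx.
  have : \forall y \near x, A y /\ J (psi y%:E).
    near=> y; split; near: y; first exact: (basic_near Pcl Pa Pb bI).
    apply: (homeo_EFin_continuous hpsi (Aab _ Ax)).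
    by apply: open_nbhs_nbhs; split => //; exact: basic_open bJ.
  move=> /nbhs_ballP[e /= e0 re].
  have [q] := @rat_in_itvoo R x (x + e) ltac:(lra).
  rewrite in_itv/= => /andP[xq qe].
  have [Aq Jq] : A (ratr q) /\ J (psi (ratr q)%:E).
    by apply: re; rewrite /ball/= distrC gtr0_norm; lra.
  exists (ratr q); first by split => //; left; exists q.
  have [s [t [sl st]]] := slope bJ.
  have Gq := st _ Jq; have Gx := st _ Jx.
  rewrite gPsi// -(real_mapE ab hpsi (Aab _ Aq)) -EFinM -EFinD in Gq.
  rewrite gPsi// -(real_mapE ab hpsi (Aab _ Ax)) -EFinM -EFinD in Gx.
  case: Gq Gx => Gq [Gx].
  have := s0P _ _ Ax Aq xq; rewrite /K Gq Gx => H.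
  (* The slope [s] of [g] on [J] also has absolute value [lambda], so only its sign is in doubt;
     [s0P] applied to [x] and the rational forces [s0 * s] to be positive. *)
  suff -> : s0 = s by lra.
  have : s = lambda \/ s = - lambda.
    by have := normrEsign s; case: (s < 0) => h; [right|left]; move: h; rewrite sl; lra.
  have H2 : 0 < s0 * s * (Psi (ratr q) - Psi x) ^+ 2 by move: H; rewrite expr2; nra.
  have H3 : 0 < s0 * s.
    by move: H2; apply: contraTT; rewrite -!leNgt => h; rewrite mulr_le0_ge0 ?sqr_ge0.
  by case=> sE; move: H3; rewrite sE; case: s0lam => -> //; nra.
have Ccount : countable C.
  pose S b := if b then @rational R else [set x | A x /\ Q (psi x%:E)].
  have CS : C `<=` \bigcup_(b in [set: bool]) S b.
    by move=> x [Ax [h|h]]; [exists true|exists false].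
  apply: (sub_countable (subset_card_le CS)).
  apply: bigcup_countable => // -[] _.
    by apply: (sub_countable (card_image_le _ _)).
  have Sinj : {in S false &, injective (psi \o EFin)}.
    move=> x y; rewrite !inE => -[Ax _] [Ay _] /= e; apply: EFin_inj.
    by apply: (homeo_inj hpsi) e; apply: ltW_between; exact: Aab.
  rewrite -(eq_countable (inj_card_eq Sinj)).
  apply: sub_countable (cpmm_countable cg).
  by apply: subset_card_le => _ [x [_ Qx] <-].
have Kcount : countable (K @` A).
  apply: (sub_countable (subset_card_le KC)).
  exact: (sub_countable (card_image_le _ _)).
have Kc := continuous_countable_image_const (basic_is_interval bI) Kct Kcount.
have [x0 Ax0] := basic_nonempty Pa Pb bI.
exists s0, (K x0); split; first by case: s0lam => ->; rewrite ?normrN gtr0_norm.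
by move=> x Ax; rewrite (Kc _ _ Ax0 Ax) /K addrC subrK.
Unshelve. all: by end_near. Qed.
End conjugacy.

(** * Lengths *)

Local Notation mu := (@lebesgue_measure _).

Section interval_length.
Context {R : realType}.

(** The endpoints are [inf A] and [sup A]. Whether they belong to [A] is left open, since this does
    not affect the length. *)
Lemma bounded_interval_between (A : set R) (M : R) : is_interval A -> A !=set0 ->
  (forall x, A x -> `|x| <= M) ->
  exists p q, [/\ p <= q, `]p, q[ `<=` A & A `<=` `[p, q]].
Proof.
move=> iA A0 bA.
have hs : has_sup A by split => //; exists M => x /bA; rewrite ler_norml => /andP[].
have hi : has_inf A by split => //; exists (- M) => x /bA; rewrite ler_norml => /andP[].
have AI x : A x -> inf A <= x <= sup A.
  by move=> Ax; rewrite ge_inf ?ub_le_sup//; first [exact: hi.2|exact: hs.2].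
exists (inf A), (sup A); split.
- by have [x /AI/andP[]] := A0; exact: le_trans.
- move=> x /=; rewrite in_itv/= => /andP[x1 x2].
  have [y Ay yx] := inf_adherent (ltac:(rewrite subr_gt0; exact: x1) : 0 < x - inf A) hi.
  have [z Az zx] := sup_adherent (ltac:(rewrite subr_gt0; exact: x2) : 0 < sup A - x) hs.
  by apply: (iA y z Ay Az); apply/andP; split; apply/ltW; lra.
- by move=> x /AI; rewrite /= in_itv.
Qed.

Lemma mu_between (A : set R) p q : is_interval A -> p <= q ->
  `]p, q[ `<=` A -> A `<=` `[p, q] -> mu A = (q - p)%:E.
Proof.
move=> iA pq A1 A2; have mA := is_interval_measurable iA.
have E1 : mu (`]p, q[%classic : set R) = (q - p)%:E.
  rewrite lebesgue_measure_itv/= lte_fin; case: ltP => // qp.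
  by rewrite (_ : q = p) ?subrr//; lra.
have E2 : mu (`[p, q]%classic : set R) = (q - p)%:E.
  rewrite lebesgue_measure_itv/= lte_fin; case: ltP => // qp.
  by rewrite (_ : q = p) ?subrr//; lra.
apply/eqP; rewrite eq_le; apply/andP; split; [rewrite -E2|rewrite -E1];
  by apply: le_measure => //; rewrite inE.
Qed.

Lemma mu_affine (A : set R) (s t M : R) : is_interval A -> (forall x, A x -> `|x| <= M) ->
  s != 0 -> mu ((fun x => s * x + t) @` A) = (`|s|%:E * mu A)%E.
Proof.
move=> iA bA s0; have [->|/set0P A0] := eqVneq A set0.
  by rewrite image_set0 measure0 mule0.
have [p [q [pq A1 A2]]] := bounded_interval_between iA A0 bA.
rewrite (mu_between iA pq A1 A2) -EFinM.
have iB : is_interval ((fun x => s * x + t) @` A).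
  move=> _ _ [x Ax <-] [y Ay <-] z /andP[z1 z2].
  have h : s * ((z - t) / s) = z - t by rewrite mulrC divfK.
  exists ((z - t) / s); last by rewrite h subrK.
  move: ((z - t) / s) h => w h.
  have h1 : s * x <= s * w by lra.
  have h2 : s * w <= s * y by lra.
  have [sp|sn] := ltP 0 s.
    by apply: (iA x y Ax Ay); apply/andP; split; rewrite -(ler_pM2l sp).
  have {}sn : s < 0 by rewrite lt_neqAle s0.
  by apply: (iA y x Ay Ax); apply/andP; split; rewrite -(ler_nM2l sn).
have [sp|sn] := ltP 0 s.
  rewrite gtr0_norm// (_ : s * (q - p) = (s * q + t) - (s * p + t)); last by lra.
  apply: mu_between => //.
  - by rewrite lerD2r ler_pM2l.
  - move=> z /=; rewrite in_itv/= => /andP[z1 z2].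
    have h : s * ((z - t) / s) = z - t by rewrite mulrC divfK.
    exists ((z - t) / s); last by rewrite h subrK.
    by apply: A1; rewrite /= in_itv/=; apply/andP; split; rewrite -(ltr_pM2l sp) h; lra.
  - move=> _ [x /A2 + <-]; rewrite /= !in_itv/= => /andP[x1 x2].
    by rewrite !lerD2r !ler_pM2l// x1.
have {}sn : s < 0 by rewrite lt_neqAle s0.
rewrite ltr0_norm// (_ : - s * (q - p) = (s * p + t) - (s * q + t)); last by lra.
apply: mu_between => //.
- by rewrite lerD2r ler_nM2l.
- move=> z /=; rewrite in_itv/= => /andP[z1 z2].
  have h : s * ((z - t) / s) = z - t by rewrite mulrC divfK.
  exists ((z - t) / s); last by rewrite h subrK.
  by apply: A1; rewrite /= in_itv/=; apply/andP; split; rewrite -(ltr_nM2l sn) h; lra.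
- move=> _ [x /A2 + <-]; rewrite /= !in_itv/= => /andP[x1 x2].
  by rewrite !lerD2r !ler_nM2l// x1 x2.
Qed.
End interval_length.

Section length_sum.
Context {R : realType}.
Variables (a b : \bar R) (P : set (\bar R)) (f : \bar R -> \bar R).
Hypothesis (cf : cpmm_pc a b P f).
Let Pcl := cpmm_closed cf.
Let Pa := cpmm_left cf.
Let Pb := cpmm_right cf.

(** Basic intervals are open and pairwise disjoint, so choosing a rational in each one is
    injective. *)
Lemma basic_countable : countable (basic_intervals a b P).
Proof.
have ch I : exists q : rat, basic_intervals a b P I -> I (ratr q)%:E.
  have [bI|nI] := pselect (basic_intervals a b P I); last by exists 0.
  have [x Ix] := basic_nonempty Pa Pb bI.
  have /nbhs_ballP[e /= e0 re] := basic_near Pcl Pa Pb bI Ix.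
  have [q] := @rat_in_itvoo R x (x + e) ltac:(lra).
  rewrite in_itv/= => /andP[xq qe]; exists q => _.
  by apply: re; rewrite /ball/= distrC gtr0_norm; lra.
have [h hP] := choice ch.
apply/countable_injP; exists (fun I => pickle (h I)) => I J.
rewrite !inE => bI bJ /(pcan_inj pickleK) e.
by apply: (basic_eq bI bJ (hP I bI)); rewrite e; exact: hP.
Qed.

(* Only a countable set of points of f(I) lies outside the basic intervals
   contained in f(I). *)
Lemma length_image_sum (Psi : R -> R) I :
  {in [set r : R | (a < r%:E < b)%E] &, injective Psi} ->
  (forall J, basic_intervals a b P J -> measurable (Psi @` rpart J : set (measurableTypeR R))) ->
  basic_intervals a b P I ->
  \esum_(J in basic_intervals a b P)
     ((transition_matrix f I J)%:E * mu (Psi @` rpart J))%E =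
  mu (Psi @` rpart (f @` I)).
Proof.
move=> inj mP bI.
pose D := basic_intervals a b P `&` [set J | J `<=` f @` I].
have cD : countable D.
  by apply: sub_countable basic_countable; apply: subset_card_le => J [].
have -> : \esum_(J in basic_intervals a b P)
     ((transition_matrix f I J)%:E * mu (Psi @` rpart J))%E =
     \esum_(J in D) mu (Psi @` rpart J).
  rewrite /D esum_mkcondr; apply: eq_esum => J _; rewrite /transition_matrix.
  case: ifPn; rewrite ?inE ?notin_setE /= => h; first by rewrite asboolT// mul1e.
  by rewrite asboolF// mul0e.
(* Enumerating the covered intervals turns the unordered sum into a series, to which countable
   additivity applies. *)
have /countable_bijP[N /card_esym/card_set_bijP[e eb]] := cD.
have De n : N n -> D (e n) by case: eb => h _ _ /h.
rewrite (reindex_esum N D e)//.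
have -> : \esum_(n in N) mu (Psi @` rpart (e n)) =
          (\sum_(n <oo | n \in N) mu (Psi @` rpart (e n)))%E.
  rewrite nneseries_esum//; congr esum.
  by apply/seteqP; split => n /=; rewrite inE.
rewrite -measure_bigcup; last 2 first.
- by move=> n /De[bn _]; exact: mP.
- move=> n m Nn Nm [y [[x nx <-] [x' mx' e']]].
  have [bn _] := De n Nn; have [bm _] := De m Nm.
  case: eb => _ ei _; apply: ei; rewrite ?inE//.
  have [hx _] := basic_sub Pa Pb bn nx; have [hx' _] := basic_sub Pa Pb bm mx'.
  apply: (basic_eq bn bm nx); suff -> : x = x' by [].
  by apply: inj; rewrite ?inE.
set U := \bigcup_(n in N) _.
(* By the Markov property, the points of [f(I)] outside the covered intervals lie in [P]; their
   image under [Psi] is countable, hence null. *)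
pose Z := Psi @` rpart ((f @` I) `&` P).
have cZ : countable Z.
  apply: (sub_countable (card_image_le _ _)).
  have EI : {in rpart ((f @` I) `&` P) &, injective (@EFin R)} by move=> x y _ _ [].
  rewrite -(eq_countable (inj_card_eq EI)).
  by apply: sub_countable (cpmm_countable cf); apply: subset_card_le => _ [x [_ Px] <-].
have -> : Psi @` rpart (f @` I) = U `|` Z.
  apply/seteqP; split => [_ [x /[dup] fIx [z Iz zx] <-]|_ [[n Nn [x nx <-]]|[x [fIx _] <-]]].
  - have [Px|Px] := pselect (P x%:E); first by right; exists x.
    left; have axb := cpmm_image_inside cf bI Iz; rewrite zx in axb.
    have [J bJ Jx] := basic_mem (ltW_between axb) Px.
    have DJ : D J by split => //; apply: (cpmm_cover cf bI bJ Iz); rewrite zx.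
    have [_ _ /(_ J DJ)[n Nn en]] := eb.
    by exists n => //; exists x => //; rewrite en.
  - by have [_ h] := De n Nn; exists x => //; exact: h.
  - by exists x.
rewrite measureU0//.
- apply: bigcup_measurable => n /De[bn _]; exact: mP.
- exact: countable_measurable.
- exact: countable_lebesgue_measure0.
Qed.

End length_sum.

(** * Necessity *)

Section affine_model.
Context {R : realType}.
Variables (a b : \bar R) (P : set (\bar R)) (f : \bar R -> \bar R) (lambda : R).
Hypotheses (cf : cpmm_pc a b P f) (mix : topologically_mixing a b f).
Hypothesis (lam1 : 1 < lambda).
Let Pcl := cpmm_closed cf.
Let Pa := cpmm_left cf.
Let Pb := cpmm_right cf.

(** What remains of a conjugacy once [g] and the endpoints are forgotten. Both halves of the theorem
    depend on the conjugacy only through such a [Psi]. *)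
Record affine_coordinate (Psi : R -> R) : Prop := AffineCoordinate {
  ac_mono :
    (forall x y : R, (a < x%:E)%E -> (y%:E < b)%E -> x < y -> Psi x < Psi y) \/
    (forall x y : R, (a < x%:E)%E -> (y%:E < b)%E -> x < y -> Psi y < Psi x) ;
  ac_continuous : forall x : R, (a < x%:E < b)%E -> {for x, continuous Psi} ;
  ac_affine : forall I, basic_intervals a b P I -> exists s t : R,
    `|s| = lambda /\ forall x : R, I x%:E -> Psi (fine (f x%:E)) = s * Psi x + t }.

(** Negation reduces lower bounds to upper bounds, and increasing coordinates to decreasing ones. *)
Lemma affine_coordinateN Psi : affine_coordinate Psi ->
  affine_coordinate (fun x => - Psi x).
Proof.
move=> [m c af]; split.
- case: m => m; [right|left] => x y ax yb xy; rewrite ltrN2; exact: m.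
- by move=> x axb; apply: cvgN; exact: c.
- move=> I bI; have [s [t [sl h]]] := af I bI.
  by exists s, (- t); split => // x Ix; rewrite h// opprD mulrN.
Qed.

Variable Psi : R -> R.
Hypothesis ac : affine_coordinate Psi.

(** The preimages of [O] and [W] under [Psi] are open and nonempty. If the first were forward
    invariant, its orbits would never meet the second, against mixing. *)
Lemma no_escape (O W : set R) : open O -> open W -> O `&` W = set0 ->
  (exists2 x : R, (a < x%:E < b)%E & O (Psi x)) ->
  (exists2 x : R, (a < x%:E < b)%E & W (Psi x)) ->
  ~ (forall x : R, (a < x%:E < b)%E -> O (Psi x) ->
       (a < f x%:E < b)%E /\ O (Psi (fine (f x%:E)))).
Proof.
move=> oO oW OW [x Ox1 Ox2] [y Wy1 Wy2] inv.
pose U (S : set R) := EFin @` [set r : R | (a < r%:E < b)%E /\ S (Psi r)].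
have oU S : open S -> open (U S).
  move=> oS; rewrite openE => _ [r [arb Sr] <-].
  have h : \forall z \near r, U S z%:E.
    near=> z; exists z => //; split; near: z; first exact: near_between.
    apply: (ac_continuous ac arb).
    by apply: open_nbhs_nbhs; split.
  by apply/nbhs_EFin.
have Uin S r : U S r%:E -> (a < r%:E < b)%E /\ S (Psi r) by move=> [z hz [<-]].
have [||n0 /(_ n0 (leqnn _))] := mix (oU _ oO) (oU _ oW).
- by exists x%:E; split; [exists x|rewrite /= in_itv/= ltW_between].
- by exists y%:E; split; [exists y|rewrite /= in_itv/= ltW_between].
move=> [w [[z [Uz _] zw] [Ww _]]].
have : U O (iter n0 f z).
  elim: n0 {zw} => //= n [r [arb Or] <-].
  have [h1 h2] := inv _ arb Or.
  by exists (fine (f r%:E)) => //=; rewrite (fine_between h1).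
rewrite zw => -[r [arb Or] rw]; move: Ww; rewrite -rw => /Uin[_ Wr].
by suff : @set0 R (Psi r) by []; rewrite -OW.
Unshelve. all: by end_near. Qed.

Definition unbounded_above I := forall M : R, exists2 x : R, I x%:E & M < Psi x.
Definition unbounded_below I := forall M : R, exists2 x : R, I x%:E & Psi x < M.

Lemma between_basic I x y z : basic_intervals a b P I -> I x%:E -> I z%:E ->
  (a < y%:E < b)%E -> Psi x < Psi y < Psi z -> I y%:E.
Proof.
move=> bI Ix Iz /andP[ay yb] /andP[xy yz].
have [/andP[ax xb] _] := basic_sub Pa Pb bI Ix.
have [/andP[az zb] _] := basic_sub Pa Pb bI Iz.
case: (ac_mono ac) => m.
  apply: (basic_convex bI Ix Iz); rewrite !lee_fin !leNgt; apply/andP; split; apply/negP => h.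
    by have := m _ _ ay xb h; lra.
  by have := m _ _ az yb h; lra.
apply: (basic_convex bI Iz Ix); rewrite !lee_fin !leNgt; apply/andP; split; apply/negP => h.
  by have := m _ _ ay zb h; lra.
by have := m _ _ ax yb h; lra.
Qed.

(** A point with large coordinate lies between two points of [I], so [I] fills the whole end where
    [Psi] is large. *)
Lemma unbounded_above_nbhs I : basic_intervals a b P I -> unbounded_above I ->
  exists M0 : R, forall x : R, (a < x%:E < b)%E -> M0 < Psi x -> I x%:E.
Proof.
move=> bI uI; have [y Iy _] := uI 0; exists (Psi y) => x axb yx.
have [z Iz xz] := uI (Psi x).
by apply: (between_basic bI Iy Iz axb); rewrite yx.
Qed.

Lemma unbounded_below_nbhs I : basic_intervals a b P I -> unbounded_below I ->
  exists M0 : R, forall x : R, (a < x%:E < b)%E -> Psi x < M0 -> I x%:E.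
Proof.
move=> bI uI; have [y Iy _] := uI 0; exists (Psi y) => x axb yx.
have [z Iz xz] := uI (Psi x).
by apply: (between_basic bI Iz Iy axb); rewrite xz.
Qed.

(** Beyond the radius [|t| / (lambda - 1)] the expansion beats the translation: [lambda * |y| - |t|]
    exceeds [|y|]. *)
Lemma affine_escape (s t y : R) : `|s| = lambda -> `|t| / (lambda - 1) < `|y| ->
  `|y| < `|s * y + t|.
Proof.
move=> sl; rewrite ltr_pdivrMr ?subr_gt0// => h.
have : `|s * y| <= `|s * y + t| + `|t| by rewrite -[X in `|X| <= _](addrK t) ler_normB.
rewrite normrM sl; lra.
Qed.

(* An unbounded basic interval would force the orbits near the infinite end(s)
   of the coordinate to escape, against mixing. *)
Lemma affine_coordinate_bounded_above I : basic_intervals a b P I ->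
  exists M : R, forall x : R, I x%:E -> Psi x <= M.
Proof.
move=> bI; apply: contrapT => nM.
have uI : unbounded_above I.
  move=> M; apply: contrapT => h; apply: nM; exists M => x Ix.
  by rewrite leNgt; apply/negP => Mx; apply: h; exists x.
have [M0 M0P] := unbounded_above_nbhs bI uI.
have [x0 Ix0 _] := uI 0.
have Iab J x : basic_intervals a b P J -> J x -> (a < x < b)%E.
  by move=> bJ /(basic_sub Pa Pb bJ)[].
(* If [Psi] is also unbounded below on some basic interval, orbits may jump between the two infinite
   ends, so the escaping set has to be the symmetric one, [M < |y|]. *)
have [[J0 [bJ0 uJ0]]|nb] := pselect (exists J, basic_intervals a b P J /\ unbounded_below J).
  have [M1 M1P] := unbounded_below_nbhs bJ0 uJ0.
  have [s [t [sl st]]] := ac_affine ac bI.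
  have [s' [t' [sl' st']]] := ac_affine ac bJ0.
  (* [M0] and [M1] place a far point in [I] or [J0], the two quotients are the radii of
     [affine_escape], and the last terms keep [x0] out of the escaping set. *)
  pose M := `|M0| + `|M1| + `|t| / (lambda - 1) + `|t'| / (lambda - 1) + `|Psi x0| + 1.
  have t1 : 0 <= `|t| / (lambda - 1) by rewrite divr_ge0// subr_ge0 ltW.
  have t2 : 0 <= `|t'| / (lambda - 1) by rewrite divr_ge0// subr_ge0 ltW.
  have n1 := ler_norm M0; have n2 := ler_norm (- M1); rewrite normrN in n2.
  have p0 := normr_ge0 M0; have p1 := normr_ge0 M1; have p2 := normr_ge0 (Psi x0).
  have nct : continuous (fun x : R => `|x|) by exact: norm_continuous.
  apply: (@no_escape [set y | M < `|y|] [set y | `|y| < M]).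
  - by apply: (@open_comp _ _ (fun x : R => `|x|) [set y | M < y]) => // ? _; exact: nct.
  - by apply: (@open_comp _ _ (fun x : R => `|x|) [set y | y < M]) => // ? _; exact: nct.
  - by apply/seteqP; split => // y [] /=; lra.
  - have [x Ix Mx] := uI M; exists x; first exact: (Iab I).
    by rewrite /=; apply: lt_le_trans Mx (ler_norm _).
  - by exists x0; [exact: (Iab I)|rewrite /= /M; lra].
  - move=> x axb /= Mx.
    have [Ix|Jx] : I x%:E \/ J0 x%:E.
      have [p|p] := leP 0 (Psi x).
        by left; apply: M0P => //; move: Mx; rewrite ger0_norm// /M; lra.
      by right; apply: M1P => //; move: Mx; rewrite ltr0_norm// /M; lra.
    + split; first exact: (cpmm_image_inside cf bI).
      rewrite st//; apply: (lt_trans Mx (affine_escape sl _)).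
      by move: Mx; rewrite /M; lra.
    + split; first exact: (cpmm_image_inside cf bJ0).
      rewrite st'//; apply: (lt_trans Mx (affine_escape sl' _)).
      by move: Mx; rewrite /M; lra.
(* In the remaining case [J] is bounded below. A negative slope on [J] would then bound [I] above,
   so the slope is [lambda]; hence [J] is unbounded above too and equals [I], and the half-line
   [M < y] is escaping. *)
have [J bJ IJ] := mixing_covered cf mix bI.
have [s [t [sl st]]] := ac_affine ac bJ.
have bd : exists L : R, forall x : R, J x%:E -> L <= Psi x.
  apply: contrapT => nL; apply: nb; exists J; split => // M; apply: contrapT => h.
  apply: nL; exists M => x Jx.
  by rewrite leNgt; apply/negP => Mx; apply: h; exists x.
have [L JL] := bd.
have cov (x : R) : I x%:E -> exists2 z : R, J z%:E & Psi x = s * Psi z + t.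
  move=> /IJ[z Jz zx]; have zE := basic_fin Pa Pb bJ Jz; rewrite zE in Jz zx.
  by exists (fine z) => //; rewrite -st// zx.
have sE : s = lambda.
  have [sp|sn] := leP 0 s; first by rewrite -sl ger0_norm.
  have [x Ix] := uI (s * L + t); have [z Jz ->] := cov x Ix.
  by have := JL _ Jz; nra.
have JI : J = I.
  have uJ : unbounded_above J.
    move=> M; have [x Ix] := uI (s * M + t); have [z Jz ->] := cov x Ix.
    by move=> h; exists z => //; move: h; rewrite ltrD2r sE ltr_pM2l ?(lt_trans _ lam1).
  have [M2 M2P] := unbounded_above_nbhs bJ uJ.
  have [x Ix Mx] := uI M2.
  by apply: (basic_eq bJ bI (M2P _ _ Mx) Ix); exact: (Iab I).
pose M := `|M0| + `|t| / (lambda - 1) + `|Psi x0| + 1.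
have t1 : 0 <= `|t| / (lambda - 1) by rewrite divr_ge0// subr_ge0 ltW.
have n1 := ler_norm M0; have n2 := ler_norm (Psi x0).
have p0 := normr_ge0 M0; have p2 := normr_ge0 (Psi x0).
apply: (@no_escape [set y | M < y] [set y | y < M]).
- exact: open_gt.
- exact: open_lt.
- by apply/seteqP; split => // y [] /=; lra.
- by have [x Ix Mx] := uI M; exists x => //; exact: (Iab I).
- by exists x0; [exact: (Iab I)|rewrite /= /M; lra].
- move=> x axb /= Mx.
  have Jx : J x%:E by rewrite JI; apply: M0P => //; move: Mx; rewrite /M; lra.
  split; first exact: (cpmm_image_inside cf bJ).
  rewrite st//; have M1 : 0 < Psi x by move: Mx; rewrite /M; lra.
  have := @affine_escape s t (Psi x) sl; rewrite (gtr0_norm M1) => h.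
  have {}h : `|t| / (lambda - 1) < Psi x by move: Mx; rewrite /M; lra.
  move: h; rewrite ltr_pdivrMr ?subr_gt0// sE => h.
  have := ler_norm (- t); rewrite normrN => h'.
  by apply: lt_le_trans Mx _; nra.
Qed.

End affine_model.

Section necessity.
Context {R : realType}.
Variables (a b : \bar R) (P : set (\bar R)) (f : \bar R -> \bar R) (lambda : R).
Hypotheses (cf : cpmm_pc a b P f) (mix : topologically_mixing a b f).
Hypothesis (lam1 : 1 < lambda).
Let Pcl := cpmm_closed cf.
Let Pa := cpmm_left cf.
Let Pb := cpmm_right cf.

Lemma affine_coordinate_bounded Psi I : affine_coordinate a b P f lambda Psi ->
  basic_intervals a b P I -> exists M : R, forall x : R, I x%:E -> `|Psi x| <= M.
Proof.
move=> ac bI.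
have [M h] := affine_coordinate_bounded_above cf mix lam1 ac bI.
have [M' h'] := affine_coordinate_bounded_above cf mix lam1 (affine_coordinateN ac) bI.
exists (`|M| + `|M'|) => x Ix; rewrite ler_norml.
have := h x Ix; have := h' x Ix; have := ler_norm M; have := ler_norm M'.
have := normr_ge0 M; have := normr_ge0 M'.
by move=> *; apply/andP; split; lra.
Qed.

(** The length of [f(I)] in the coordinate [Psi] is computed twice: as [lambda] times that of [I],
    because [f] is affine there, and as the sum of the lengths of the basic intervals it covers. *)
Lemma affine_coordinate_eigenvector Psi : affine_coordinate a b P f lambda Psi ->
  exists v : set (\bar R) -> R, nonneg_eigenvector a b P f lambda v.
Proof.
move=> ac.
pose w I := mu (Psi @` rpart I); pose v I := fine (w I).
have inj : {in [set r : R | (a < r%:E < b)%E] &, injective Psi}.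
  move=> x y; rewrite !inE => /andP[ax xb] /andP[ay yb] e.
  apply/eqP; rewrite eq_le !leNgt; apply/andP; split; apply/negP => h;
    case: (ac_mono ac) => m.
  - by have := m _ _ ay xb h; rewrite e ltxx.
  - by have := m _ _ ay xb h; rewrite e ltxx.
  - by have := m _ _ ax yb h; rewrite e ltxx.
  - by have := m _ _ ax yb h; rewrite e ltxx.
have iv I : basic_intervals a b P I -> is_interval (Psi @` rpart I).
  move=> bI; apply/connected_intervalP; apply: connected_continuous_connected.
    by apply/connected_intervalP; exact: basic_is_interval bI.
  apply: continuous_in_subspaceT => x; rewrite inE => Ix.
  by apply: (ac_continuous ac); have [] := basic_sub Pa Pb bI Ix.
have nonempty I : basic_intervals a b P I -> exists p q, [/\ p < q, I p%:E & I q%:E].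
  move=> bI; have [y Ix] := basic_nonempty Pa Pb bI.
  have /nbhs_ballP[e /= e0 re] := basic_near Pcl Pa Pb bI Ix.
  exists y, (y + e / 2); split => //; first lra.
  by apply: re; rewrite /ball/= opprD addrA subrr sub0r normrN gtr0_norm; lra.
have wE I : basic_intervals a b P I ->
    exists p q, [/\ p < q, w I = (q - p)%:E & v I = q - p].
  move=> bI; have [M bM] := affine_coordinate_bounded ac bI.
  have [x [y [xy Ix Iy]]] := nonempty I bI.
  have bA z : (Psi @` rpart I) z -> `|z| <= M by move=> [r Ir <-]; exact: bM.
  have [|p [q [pq A1 A2]]] := bounded_interval_between (iv I bI) _ bA.
    by exists (Psi x), x.
  have E : w I = (q - p)%:E by exact: mu_between (iv I bI) pq A1 A2.
  exists p, q; split => //; last by rewrite /v E.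
  rewrite lt_neqAle pq andbT; apply/eqP => epq.
  have inA z : I z%:E -> Psi z = p.
    move=> Iz; have : (Psi @` rpart I) (Psi z) by exists z.
    by move=> /A2; rewrite /= in_itv/= -epq => h; apply/eqP; rewrite eq_le andbC.
  have : x = y.
    apply: inj; rewrite ?inA// inE /=; first by have [] := basic_sub Pa Pb bI Ix.
    by have [] := basic_sub Pa Pb bI Iy.
  by move=> h; move: xy; rewrite h ltxx.
exists v; split.
- by move=> I /wE[p [q [pq _ ->]]]; rewrite subr_ge0 ltW.
- have [r arb] : exists r : R, (a < r%:E < b)%E.
    have ab := cpmm_lt cf; move: (a) (b) ab => [a'||] [b'||]// ab.
    + by move: ab; rewrite lte_fin => ab; exists ((a' + b') / 2); rewrite !lte_fin; lra.
    + by exists (a' + 1); rewrite lte_fin ltry andbT; lra.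
    + by exists (b' - 1); rewrite lte_fin ltNyr /=; lra.
    + by exists 0; rewrite ltry ltNyr.
  (* All lengths are positive, so it is enough that some basic interval exists, and this holds
     because []a, b[] is uncountable. *)
  suff [x axb Px] : exists2 x : R, (a < x%:E < b)%E & ~ P x%:E.
    have [I bI _] := basic_mem (ltW_between axb) Px.
    exists I => //; have [p [q [pq _ ->]]] := wE _ bI.
    by rewrite subr_eq0 gt_eqF.
  apply: contrapT => h.
  have /nbhs_ballP[e /= e0 re] := near_between arb.
  apply: (@itv_not_countable R r (r + e)); first lra.
  have EI : {in (`]r, r + e[%classic : set R) &, injective (@EFin R)} by move=> x y _ _ [].
  rewrite -(eq_countable (inj_card_eq EI)).
  apply: sub_countable (cpmm_countable cf).
  apply: subset_card_le => _ [x /= + <-]; rewrite in_itv/= => /andP[x1 x2].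
  apply: contrapT => Px; apply: h; exists x => //.
  by apply: re; rewrite /ball/= distrC gtr0_norm; lra.
- move=> I bI.
  have -> : \esum_(J in basic_intervals a b P) (transition_matrix f I J * v J)%:E
          = \esum_(J in basic_intervals a b P) ((transition_matrix f I J)%:E * w J)%E.
    by apply: eq_esum => J /wE[p [q [_ -> ->]]]; rewrite EFinM.
  rewrite (length_image_sum cf)//; last first.
    by move=> J bJ; apply: is_interval_measurable; exact: iv.
  have [s [t [sl st]]] := ac_affine ac bI.
  have -> : Psi @` rpart (f @` I) = (fun y => s * y + t) @` (Psi @` rpart I).
    apply/seteqP; split => [_ [y [z Iz zy] <-]|_ [_ [x Ix <-] <-]].
      have zE := basic_fin Pa Pb bI Iz; rewrite zE in Iz zy.
      exists (Psi (fine z)); first by exists (fine z).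
      by rewrite -st// zy.
    have axb := cpmm_image_inside cf bI Ix.
    exists (fine (f x%:E)); last by rewrite st.
    by exists x%:E => //; rewrite (fine_between axb).
  have [M bM] := affine_coordinate_bounded ac bI.
  rewrite (@mu_affine _ _ _ _ M) ?sl.
  + by have [p [q [_ wI ->]]] := wE _ bI; rewrite -/(w I) wI EFinM.
  + exact: iv.
  + by move=> _ [x Ix <-]; exact: bM.
  + by rewrite -normr_eq0 sl gt_eqF// (lt_trans _ lam1).
Qed.

Lemma conj_affine_coordinate (c d : \bar R) (Q : set (\bar R)) (g psi : \bar R -> \bar R) :
  cpmm_pc c d Q g -> constant_slope c d Q g lambda -> conjugate_via a b c d f g psi ->
  affine_coordinate a b P f lambda (real_map psi).
Proof.
move=> cg slope conj; split.
- exact: (real_map_mono (cpmm_lt cf) conj.1).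
- by move=> x; exact: (real_map_continuous (cpmm_lt cf) conj.1).
- by move=> I; apply: (conj_affine cf cg slope _ conj); rewrite (lt_trans _ lam1).
Qed.

End necessity.

(** * The example *)

Section example.
Context {R : realType}.
Implicit Types (m k : int) (p q u w x : R) (z : \bar R) (A B C : set (\bar R)).

(** Left endpoint of the image of [(m, m + 1)] in the coordinate [u = 1/x]. The values at [-1] and
    [0] only matter for the partition points with these coordinates. *)
Definition ex_shift m : int :=
  if m == 1 then - 4 else if m == - 2 then 1 else m - 1.

Definition ex_lift u : R :=
  3 * (u - (Num.floor u)%:~R) + (ex_shift (Num.floor u))%:~R.

(** The convention [0^-1 = 0] gives the point [0] the coordinate [0], which is lifted to [-1]; thus
    [0] is sent to [-1], again a partition point. *)
Definition ex_map z : \bar R := ((ex_lift (fine z)^-1)^-1)%:E.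

(* The point 0 belongs to this set because 0^-1 = 0. *)
Definition ex_partition : set (\bar R) := range (fun m => ((m%:~R : R)^-1)%:E).

(** The indices [-1] and [0] are left out because [[-1, 1]] corresponds to [|u| >= 1], apart from
    the point [0]. *)
Definition ex_index m := (1 <= m) || (m <= - 2).

(** With [n = 1] these are the basic intervals, with [n = 3] their images. *)
Definition ex_piece m n : set (\bar R) :=
  [set ((u^-1)%:E : \bar R) | u in `]m%:~R, (m + n)%:~R[].

Lemma ex_shift_cases m : ex_index m ->
  (1 <= ex_shift m) || (ex_shift m <= - 4).
Proof. by rewrite /ex_index /ex_shift; do ! case: eqP; lia. Qed.

Lemma floorE m u : m%:~R <= u < (m + 1)%:~R -> Num.floor u = m.
Proof. exact: floor_def. Qed.

Lemma ex_liftE m u : m%:~R <= u < (m + 1)%:~R ->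
  ex_lift u = 3 * (u - m%:~R) + (ex_shift m)%:~R.
Proof. by move=> /floorE E; rewrite /ex_lift E. Qed.

Lemma ex_mapV u : ex_map (u^-1)%:E = ((ex_lift u)^-1)%:E.
Proof. by rewrite /ex_map /= invrK. Qed.

Lemma ex_pieceP m n u : ex_piece m n (u^-1)%:E <-> m%:~R < u < (m + n)%:~R.
Proof.
split; last by move=> h; exists u => //=; rewrite in_itv.
by move=> [w + [/invr_inj <-]]; rewrite /= in_itv.
Qed.

Lemma ex_piece_fin m n z : ex_piece m n z -> exists2 u, z = (u^-1)%:E & m%:~R < u < (m + n)%:~R.
Proof. by move=> [u + <-]; rewrite /= in_itv/= => h; exists u. Qed.

(** Inversion reverses the order only on each side of [0] separately, so every comparison of
    inverses needs the common sign. *)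
Lemma itv_sign m n u : 0 <= n -> (1 <= m) || (m + n <= - 1) -> m%:~R < u < (m + n)%:~R ->
  (0 < m%:~R :> R) /\ 1 < u \/ ((m + n)%:~R < 0 :> R) /\ u < - 1.
Proof.
move=> n0 /orP[] h /andP[u1 u2]; [left|right].
  have h' : 1 <= m%:~R :> R by rewrite (ler_int _ 1).
  by split; lra.
have h' : (m + n)%:~R <= - 1 :> R by rewrite -[- 1]/((- 1)%:~R) ler_int.
by split; lra.
Qed.

Lemma ex_pieceE m n : 0 < n -> (1 <= m) || (m + n <= - 1) ->
  ex_piece m n = `](((m + n)%:~R : R)^-1)%:E, ((m%:~R : R)^-1)%:E[%classic.
Proof.
move=> n0 hm; apply/seteqP; split => z.
  move=> /ex_piece_fin[u -> /[dup] /andP[u1 u2] /(itv_sign (ltW n0) hm) h].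
  rewrite /= in_itv/= ?lte_fin.
  case: h => -[h1 h2].
    by rewrite !ltf_pV2 ?posrE ?u1 ?u2//; lra.
  by rewrite !ltf_nV2 ?negrE ?u1 ?u2//; lra.
rewrite /= in_itv/=; case: z => [x| |] /andP[] //; rewrite !lte_fin => x1 x2.
rewrite -[x]invrK; apply/ex_pieceP.
have lt_mn : m%:~R < (m + n)%:~R :> R by rewrite ltr_int; lia.
case/orP: hm => h.
  have h' : 1 <= m%:~R :> R by rewrite (ler_int _ 1).
  have i0 : 0 < ((m + n)%:~R : R)^-1 by rewrite invr_gt0; lra.
  have x0 : 0 < x by lra.
  have m0 : 0 < (m%:~R : R)^-1 by rewrite invr_gt0; lra.
  by rewrite -[X in X < _ < _]invrK -[X in _ < _ < X]invrK !ltf_pV2 ?posrE// x1 x2.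
have h' : (m + n)%:~R <= - 1 :> R by rewrite -[- 1]/((- 1)%:~R) ler_int.
have i0 : (m%:~R : R)^-1 < 0 by rewrite invr_lt0; lra.
have x0 : x < 0 by lra.
have n1 : ((m + n)%:~R : R)^-1 < 0 by rewrite invr_lt0; lra.
by rewrite -[X in X < _ < _]invrK -[X in _ < _ < X]invrK !ltf_nV2 ?negrE// x1 x2.
Qed.

Lemma ex_piece_open m n : 0 < n -> (1 <= m) || (m + n <= - 1) -> open (ex_piece m n).
Proof.
move=> n0 hm; rewrite ex_pieceE//.
rewrite (_ : `]_, _[%classic = [set x : \bar R | (((m + n)%:~R : R)^-1)%:E < x]%E `&`
   [set x : \bar R | (x < ((m%:~R : R)^-1)%:E)%E]).
  by apply: openI; [exact: open_ereal_gt_ereal|exact: open_ereal_lt_ereal].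
by apply/seteqP; split => x /=; rewrite in_itv/= => /andP.
Qed.

Lemma int_itv_empty m k : ~~ ((m%:~R : R) < (k%:~R : R) < (m + 1)%:~R).
Proof. by rewrite !ltr_int; lia. Qed.

Lemma ex_piece_partition m z : ex_piece m 1 z -> ~ ex_partition z.
Proof.
move=> /ex_piece_fin[u -> h] [k _ [/invr_inj ku]]; move: h; rewrite -ku.
by apply/negP; exact: int_itv_empty.
Qed.

(** The index is the floor of [1/x], and [1 <= |1/x|] for nonzero [x] excludes [-1] and [0] when
    [1/x] is not an integer. *)
Lemma ex_cover z : (- 1%:E <= z <= 1%:E)%E ->
  ex_partition z \/ exists2 m, ex_index m & ex_piece m 1 z.
Proof.
case: z => [x| |] /andP[] //; rewrite -EFinN !lee_fin => x1 x2.
have [m1 m2] := andP (floor_itv x^-1); set m := Num.floor x^-1 in m1 m2.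
have [e|ne] := eqVneq x^-1 m%:~R.
  by left; exists m => //; rewrite -e invrK.
right; have h : m%:~R < x^-1 < (m + 1)%:~R by rewrite m2 lt_neqAle m1 eq_sym ne.
exists m; last by rewrite -[x]invrK; apply/ex_pieceP.
have x0 : x != 0 by apply: contraNneq ne => x0; move: m1 m2; rewrite /m x0 invr0 floor0.
rewrite /ex_index; have [xp|xn] := ltP 0 x.
  have : 1 <= x^-1 by rewrite invf_ge1.
  move=> h1; have : (0 : int)%:~R < (m + 1)%:~R :> R by apply: le_lt_trans m2; lra.
  rewrite ltr_int => h2; have : m != 0.
    apply: contraTneq h1 => m0; move: h; rewrite m0 add0r => /andP[_]; rewrite -ltNge; exact.
  lia.
have {}xn : x < 0 by rewrite lt_neqAle x0.
have h1 : x^-1 <= - 1.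
  by rewrite -[- 1]invrK lef_nV2 ?negrE// invrN invr1//; lra.
have : m%:~R < (- 1)%:~R :> R by case/andP: h => h _; apply: lt_le_trans h _.
by rewrite ltr_int; lia.
Qed.

Lemma ex_indexE m : ex_index m = (1 <= m) || (m + 1 <= - 1).
Proof. by rewrite /ex_index; lia. Qed.

Lemma ex_partition_sub z : ex_partition z -> (- 1%:E <= z <= 1%:E)%E.
Proof.
move=> [k _ <-]; rewrite -EFinN !lee_fin -ler_norml.
have [->|k0] := eqVneq k 0; first by rewrite invr0 normr0.
rewrite normfV invf_le1 ?normr_gt0 ?intr_eq0//.
by rewrite -intr_norm (ler_int _ 1); lia.
Qed.

Lemma ex_closed : closed ex_partition.
Proof.
rewrite -openC openE => z Pz; rewrite /interior.
have [zab|] := boolP (- 1%:E <= z <= 1%:E)%E.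
  have [//|[m im mz]] := ex_cover zab.
  rewrite ex_indexE in im.
  have : nbhs z (ex_piece m 1) by apply: open_nbhs_nbhs; split => //; exact: ex_piece_open.
  by apply: filterS => y /ex_piece_partition.
rewrite negb_and -!ltNge => /orP[] h.
  have : nbhs z [set y | (y < - 1%:E)%E].
    by apply: open_nbhs_nbhs; split => //; exact: open_ereal_lt_ereal.
  by apply: filterS => y /= y1 /ex_partition_sub; rewrite leNgt y1.
have : nbhs z [set y | (1%:E < y)%E].
  by apply: open_nbhs_nbhs; split => //; exact: open_ereal_gt_ereal.
by apply: filterS => y /= y1 /ex_partition_sub; rewrite andbC leNgt y1.
Qed.
Local Notation ex_basic := (basic_intervals (- 1%:E)%E 1%:E ex_partition).

Lemma ex_partition_int m : ex_partition ((m%:~R : R)^-1)%:E.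
Proof. by exists m. Qed.

Lemma ex_partition_left : ex_partition (- 1%:E)%E.
Proof. by exists (- 1) => //; rewrite -EFinN mulrN1z invrN invr1. Qed.

Lemma ex_partition_right : ex_partition 1%:E.
Proof. by exists 1 => //; rewrite mulr1z invr1. Qed.

Lemma ex_piece_basic m : ex_index m -> ex_basic (ex_piece m 1).
Proof.
move=> im; have im' := im; rewrite ex_indexE in im'.
have E := @ex_pieceE m 1 isT im'; rewrite E.
have lt_mn : m%:~R < (m + 1)%:~R :> R by rewrite ltr_int; lia.
apply: basic_gap => //.
- exact: ex_partition_left.
- exact: ex_partition_right.
- exact: ex_partition_int.
- exact: ex_partition_int.
- by have /andP[] := ex_partition_sub (ex_partition_int (m + 1)).
- by have /andP[] := ex_partition_sub (ex_partition_int m).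
- rewrite lte_fin; case/orP: im' => h.
    have h' : 1 <= m%:~R :> R by rewrite (ler_int _ 1).
    by rewrite ltf_pV2 ?posrE//; lra.
  have h' : (m + 1)%:~R <= - 1 :> R by rewrite -[- 1]/((- 1)%:~R) ler_int.
  by rewrite ltf_nV2 ?negrE//; lra.
- by move=> z hz; apply: (@ex_piece_partition m); rewrite E /= in_itv.
Qed.

Lemma ex_basicP I : ex_basic I -> exists2 m, ex_index m & I = ex_piece m 1.
Proof.
move=> bI; have [y Iyy] := basic_nonempty ex_partition_left ex_partition_right bI.
have [/ltW_between yab Py] := basic_sub ex_partition_left ex_partition_right bI Iyy.
have [//|[m im my]] := ex_cover yab.
by exists m => //; apply: (basic_eq bI (ex_piece_basic im) Iyy my).
Qed.

Lemma ex_map_piece m u : m%:~R < u < (m + 1)%:~R ->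
  ex_map (u^-1)%:E = ((3 * (u - m%:~R) + (ex_shift m)%:~R)^-1)%:E.
Proof. by move=> /andP[u1 u2]; rewrite ex_mapV (@ex_liftE m)// u2 ltW. Qed.

Lemma ex_map_image m : ex_map @` ex_piece m 1 = ex_piece (ex_shift m) 3.
Proof.
apply/seteqP; split => [_ [_ /ex_piece_fin[u -> mu] <-]|_ /ex_piece_fin[w -> mw]].
  rewrite (ex_map_piece mu); apply/ex_pieceP; move: mu => /andP[].
  by rewrite !intrD => u1 u2; apply/andP; split; lra.
have h : m%:~R < (w - (ex_shift m)%:~R) / 3 + m%:~R < (m + 1)%:~R.
  by move: mw => /andP[]; rewrite !intrD => w1 w2; apply/andP; split; lra.
exists ((((w - (ex_shift m)%:~R) / 3 + m%:~R)^-1)%:E); first exact/ex_pieceP.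
by rewrite (ex_map_piece h); congr (_%:E); congr (_^-1); lra.
Qed.

Lemma ex_shift_side m : ex_index m -> (1 <= ex_shift m) || (ex_shift m + 3 <= - 1).
Proof. by move=> /ex_shift_cases; lia. Qed.

(** An increasing affine map in [u] is taken between two order-reversing inversions; neither the
    piece nor its image straddles [0]. *)
Lemma ex_map_monotone m : ex_index m ->
  {in ex_piece m 1 &, {homo ex_map : x y / (x < y)%E}}.
Proof.
move=> im _ _ /set_mem/ex_piece_fin[u -> hu] /set_mem/ex_piece_fin[w -> hw].
have := hu; have := hw; rewrite ex_indexE in im.
move=> /(@itv_sign _ 1 _ isT im) sw /(@itv_sign _ 1 _ isT im) su.
have h : u^-1 < w^-1 -> w < u.
  case: su sw => -[s1 s2] [] [s3 s4]; try lra.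
    by rewrite ltf_pV2 ?posrE; lra.
  by rewrite ltf_nV2 ?negrE; lra.
rewrite lte_fin => /h wu; rewrite (ex_map_piece hu) (ex_map_piece hw) lte_fin.
have im' : ex_index m by rewrite ex_indexE.
have hU : (ex_shift m)%:~R < 3 * (u - m%:~R) + (ex_shift m)%:~R < (ex_shift m + 3)%:~R.
  by move: hu => /andP[]; rewrite !intrD => u1 u2; apply/andP; split; lra.
have hW : (ex_shift m)%:~R < 3 * (w - m%:~R) + (ex_shift m)%:~R < (ex_shift m + 3)%:~R.
  by move: hw => /andP[]; rewrite !intrD => u1 u2; apply/andP; split; lra.
have sU := @itv_sign _ 3 _ isT (ex_shift_side im') hU.
have sW := @itv_sign _ 3 _ isT (ex_shift_side im') hW.
have lt : 3 * (w - m%:~R) + (ex_shift m)%:~R < 3 * (u - m%:~R) + (ex_shift m)%:~R by lra.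
move: (3 * (u - _) + _) (3 * (w - _) + _) lt sU sW => U W lt sU sW.
case: sU sW => -[s1 s2] [] [s3 s4]; try lra.
  by rewrite ltf_pV2 ?posrE; lra.
by rewrite ltf_nV2 ?negrE; lra.
Qed.

Lemma ex_map_continuous m : ex_index m -> {within ex_piece m 1, continuous ex_map}.
Proof.
move=> im; have im' := im; rewrite ex_indexE in im'.
have op := @ex_piece_open m 1 isT im'.
rewrite continuous_open_subspace// => z /set_mem mz.
have [u zu hu] := ex_piece_fin mz.
have su := @itv_sign _ 1 _ isT im' hu.
have hU : (ex_shift m)%:~R < 3 * (u - m%:~R) + (ex_shift m)%:~R < (ex_shift m + 3)%:~R.
  by move: hu => /andP[]; rewrite !intrD => u1 u2; apply/andP; split; lra.
have sU := @itv_sign _ 3 _ isT (ex_shift_side im) hU.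
pose h x : R := (3 * (x^-1 - m%:~R) + (ex_shift m)%:~R)^-1.
have hc : h @ u^-1 --> h u^-1.
  apply: cvgV; first by rewrite invrK; apply/eqP; case: sU; lra.
  apply: cvgD; last exact: cvg_cst.
  apply: cvgMr; apply: cvgB; last exact: cvg_cst.
  apply: cvgV; last exact: cvg_id.
  by rewrite invr_eq0; apply/eqP; case: su; lra.
have E : \forall x \near u^-1, ex_map x%:E = (h x)%:E.
  have : nbhs (u^-1)%:E (ex_piece m 1) by apply: open_nbhs_nbhs; split => //; rewrite -zu.
  move=> /nbhs_EFin; apply: filterS => x /ex_piece_fin[w [xw] hw].
  by rewrite xw (ex_map_piece hw) /h invrK.
rewrite zu /continuous_at (ex_map_piece hu).
have -> : (3 * (u - m%:~R) + (ex_shift m)%:~R)^-1 = h u^-1 by rewrite /h invrK.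
have H : (ex_map \o EFin) @ u^-1 --> (h u^-1)%:E.
  apply: (cvg_trans (near_eq_cvg _) (_ : (EFin \o h) @ u^-1 --> (h u^-1)%:E)).
    by apply: filterS E => x /= ->.
  by apply: cvg_EFin; [exact: nearW|].
exact: H.
Qed.

(** In the coordinate [u] the image has integer endpoints, so it either contains a given unit
    interval or misses it. *)
Lemma ex_map_markov m k : 
  ex_map @` ex_piece m 1 `&` ex_piece k 1 = set0 \/ ex_piece k 1 `<=` ex_map @` ex_piece m 1.
Proof.
rewrite ex_map_image; have [h|h] := boolP ((ex_shift m <= k) && (k + 1 <= ex_shift m + 3)).
  right => _ /ex_piece_fin[u -> /andP[u1 u2]]; apply/ex_pieceP.
  have h1 : (ex_shift m)%:~R <= k%:~R :> R by rewrite ler_int; case/andP: h.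
  have h2 : (k + 1)%:~R <= (ex_shift m + 3)%:~R :> R by rewrite ler_int; case/andP: h.
  by apply/andP; split; lra.
left; apply/seteqP; split => // z [/ex_piece_fin[u -> /andP[u1 u2]] /ex_pieceP/andP[u3 u4]].
have : (ex_shift m)%:~R < (k + 1)%:~R :> R by lra.
have : k%:~R < (ex_shift m + 3)%:~R :> R by lra.
rewrite !ltr_int => h1 h2; exfalso; move: h; lia.
Qed.

Lemma ex_map_self z : (- 1%:E <= z <= 1%:E)%E -> (- 1%:E <= ex_map z <= 1%:E)%E.
Proof.
move=> zab; have [|[m im mz]] := ex_cover zab.
  move=> [k _ <-]; rewrite ex_mapV (@ex_liftE k) ?lexx ?ltr_int; last by lia.
  rewrite subrr mulr0 add0r; apply: ex_partition_sub; exact: ex_partition_int.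
have : (ex_map @` ex_piece m 1) (ex_map z) by exists z.
rewrite ex_map_image => /ex_piece_fin[u ->].
move=> /(@itv_sign _ 3 _ isT (ex_shift_side im)) h; rewrite -EFinN !lee_fin -ler_norml.
have u1 : 1 < `|u| by case: h => -[_ h]; [rewrite gtr0_norm|rewrite ltr0_norm]; lra.
by rewrite normfV invf_le1 ?ltW//; lra.
Qed.

Lemma ex_cpmm : cpmm_pc (- 1%:E)%E 1%:E ex_partition ex_map.
Proof.
split.
- by rewrite -EFinN lte_fin; lra.
- by move=> _ [z /= + <-]; rewrite !in_itv/=; exact: ex_map_self.
- by move=> z /ex_partition_sub; rewrite /= in_itv.
- exact: ex_closed.
- by apply: (sub_countable (card_image_le _ _)).
- exact: ex_partition_left.
- exact: ex_partition_right.
- move=> _ [_ [k _ <-] <-]; rewrite ex_mapV (@ex_liftE k) ?lexx ?ltr_int; last by lia.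
  rewrite subrr mulr0 add0r; exact: ex_partition_int.
- by move=> I /ex_basicP[m im ->]; exact: ex_map_continuous.
- by move=> I /ex_basicP[m im ->]; left; exact: ex_map_monotone.
- by move=> I J /ex_basicP[m im ->] /ex_basicP[k ik ->]; exact: ex_map_markov.
Qed.

Lemma ex_piece_inv m n : (@GRing.inv R) @` rpart (ex_piece m n) = `]m%:~R, (m + n)%:~R[%classic.
Proof.
apply/seteqP; split => [_ [x /= + <-]|u]; rewrite /= in_itv/=.
  by rewrite -{1}[x]invrK => /ex_pieceP.
by move=> hu; exists u^-1; [exact/ex_pieceP|rewrite invrK].
Qed.

(** Lengths in the coordinate [u] are fed to [length_image_sum], with inversion as [Psi]: pieces
    have length 1 and their images length 3. *)
Lemma ex_eigenvector :
  nonneg_eigenvector (- 1%:E)%E 1%:E ex_partition ex_map 3 (fun=> 1).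
Proof.
have len m n : 0 < n -> mu ((@GRing.inv R) @` rpart (ex_piece m n)) = (n%:~R)%:E.
  move=> n0; rewrite ex_piece_inv lebesgue_measure_itv/= lte_fin ltr_int ltrDl n0.
  by rewrite -EFinB intrD; congr (_%:E); lra.
have ex1 : ex_index 1 by [].
split => //.
- by exists (ex_piece 1 1); [exact: ex_piece_basic|exact: oner_neq0].
- move=> I bI.
  have -> : \esum_(J in ex_basic) (transition_matrix ex_map I J * 1)%:E =
    \esum_(J in ex_basic) ((transition_matrix ex_map I J)%:E * mu ((@GRing.inv R) @` rpart J))%E.
    by apply: eq_esum => J /ex_basicP[m im ->]; rewrite len// EFinM.
  rewrite (length_image_sum ex_cpmm)//.
  + have [m im ->] := ex_basicP bI.
    by rewrite ex_map_image len// mulr1.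
  + by move=> x y _ _; exact: invr_inj.
  + move=> J /ex_basicP[m im ->]; rewrite ex_piece_inv.
    by apply: is_interval_measurable; exact: interval_is_interval.
Qed.

(** * Mixing of the example *)

Definition ex_arc p q : set (\bar R) := [set ((u^-1)%:E : \bar R) | u in `]p, q[].

Lemma ex_arcS p q p' q' : p <= p' -> q' <= q -> ex_arc p' q' `<=` ex_arc p q.
Proof.
move=> pp qq _ [u + <-]; rewrite /= in_itv/= => /andP[u1 u2]; exists u => //=.
by rewrite in_itv/=; apply/andP; split; lra.
Qed.

Lemma ex_map_arc m p q : m%:~R <= p -> q <= (m + 1)%:~R ->
  ex_arc (3 * (p - m%:~R) + (ex_shift m)%:~R) (3 * (q - m%:~R) + (ex_shift m)%:~R)
    `<=` ex_map @` ex_arc p q.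
Proof.
move=> mp qm _ [w + <-]; rewrite /= in_itv/= => /andP[w1 w2].
have h : p < (w - (ex_shift m)%:~R) / 3 + m%:~R < q by apply/andP; split; lra.
have h' : m%:~R < (w - (ex_shift m)%:~R) / 3 + m%:~R < (m + 1)%:~R.
  by move: h => /andP[? ?]; apply/andP; split; lra.
exists ((((w - (ex_shift m)%:~R) / 3 + m%:~R)^-1)%:E).
  by eexists; [|reflexivity]; rewrite /= in_itv.
by rewrite (ex_map_piece h'); congr (_%:E); congr (_^-1); lra.
Qed.

(** Such coverings compose like paths in the transition graph, the times adding up. *)
Definition ex_covers n A B := B `<=` iter n ex_map @` A.

Lemma ex_covers_trans n l A B C :
  ex_covers n A B -> ex_covers l B C -> ex_covers (n + l) A C.
Proof.
move=> AB BC _ /BC[y /AB[x Ax <-] <-].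
by exists x => //; rewrite addnC iterD.
Qed.

Lemma ex_covers_edge m k : ex_index m -> (ex_shift m <= k <= ex_shift m + 2) ->
  ex_covers 1%N (ex_piece m 1) (ex_piece k 1).
Proof.
move=> im /andP[h1 h2].
rewrite /ex_covers /= ex_map_image => _ /ex_piece_fin[u -> /andP[u1 u2]].
apply/ex_pieceP.
have h3 : (ex_shift m)%:~R <= k%:~R :> R by rewrite ler_int.
have h4 : (k + 1)%:~R <= (ex_shift m + 3)%:~R :> R by rewrite ler_int; lia.
by apply/andP; split; lra.
Qed.

(** The map triples an arc, and cutting the image at one integer keeps at least half of it, so the
    length grows by 3/2 per step until a whole piece is covered. *)
Lemma ex_arc_grows n p q m : ex_index m -> m%:~R <= p -> p < q -> q <= (m + 1)%:~R ->
  1 <= (3 / 2) ^+ n * (q - p) ->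
  exists N k, ex_index k /\ ex_covers N (ex_arc p q) (ex_piece k 1).
Proof.
elim: n p q m => [|n IH] p q m im mp pq qm.
  rewrite expr0 mul1r => pq1; exists 0%N, m; split => //.
  have -> : p = m%:~R by move: qm; rewrite intrD; lra.
  have -> : q = (m + 1)%:~R by move: qm; rewrite intrD; lra.
  by move=> z hz; exists z.
rewrite exprS => len; set d := ex_shift m.
pose p' := 3 * (p - m%:~R) + d%:~R; pose q' := 3 * (q - m%:~R) + d%:~R.
have img : ex_arc p' q' `<=` iter 1 ex_map @` ex_arc p q by exact: ex_map_arc.
have dp : d%:~R <= p' by rewrite /p'; lra.
have qd : q' <= (d + 3)%:~R by move: qm; rewrite /q' !intrD; lra.
have len' : q' - p' = 3 * (q - p) by rewrite /q' /p'; lra.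
have pq' : p' < q' by lra.
have step k p2 q2 : ex_index k -> p' <= p2 -> p2 < q2 -> q2 <= q' ->
    k%:~R <= p2 -> q2 <= (k + 1)%:~R -> (q' - p') / 2 <= q2 - p2 ->
    exists N k, ex_index k /\ ex_covers N (ex_arc p q) (ex_piece k 1).
  move=> ik h1 h2 h3 h4 h5 h6; have [|N [k' [ik' cv]]] := IH p2 q2 k ik h4 h2 h5.
    apply: le_trans len _; rewrite -mulrA mulrCA ler_pM2l ?exprn_gt0//; lra.
  exists (1 + N)%N, k'; split => //; apply: ex_covers_trans cv.
  by move=> z /(ex_arcS h1 h3) /img.
have [k1 k2] := andP (floor_itv p'); set k := Num.floor p' in k1 k2.
have dk : d <= k by rewrite -ltzD1 -(ltr_int R); lra.
have kd : k <= d + 2.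
  have : k < d + 3 by rewrite -(ltr_int R); lra.
  lia.
have side := ex_shift_side im; rewrite -/d in side.
have ik : ex_index k by rewrite /ex_index; lia.
(* The image lies in one piece, or contains the next piece entirely, or is cut at [k + 1] and its
   longer half is kept. *)
have [le1|gt1] := leP q' (k + 1)%:~R.
  by apply: (step k p' q') => //; lra.
have kd' : k + 1 < d + 3 by rewrite -(ltr_int R); lra.
have ik1 : ex_index (k + 1) by rewrite /ex_index; lia.
have [le2|gt2] := leP (k + 1 + 1)%:~R q'.
  exists 1%N, (k + 1); split => // z hz; apply: img.
  by apply: (@ex_arcS _ _ (k + 1)%:~R (k + 1 + 1)%:~R) hz; lra.
have [h|h] := leP ((q' - p') / 2) ((k + 1)%:~R - p').
  by apply: (step k p' (k + 1)%:~R) => //; lra.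
by apply: (step (k + 1) (k + 1)%:~R q') => //; lra.
Qed.

Lemma expr_unbounded (l : R) : 0 < l -> exists n, 1 <= (3 / 2) ^+ n * l.
Proof.
move=> l0; have bern n : 1 + n%:R / 2 <= (3 / 2 : R) ^+ n.
  elim: n => [|n IH]; first by rewrite expr0; lra.
  by rewrite exprS -addn1 natrD; have := ler0n R n; lra.
have [n hn] : exists n : nat, 2 / l < n%:R.
  by eexists; exact: truncnS_gt.
exists n; have := bern n; move: hn; rewrite ltr_pdivrMr// => h1 h2.
by apply: le_trans (_ : (1 + n%:R / 2) * l <= _); [nra|rewrite ler_pM2r].
Qed.

(** The interval [(2, 3)] is sent onto [(1, 4)] and so covers itself; waiting there makes all large
    times available for mixing. *)
Lemma ex_covers_loop n : ex_covers n (ex_piece 2 1) (ex_piece 2 1).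
Proof.
elim: n => [|n IH]; first by move=> z hz; exists z.
by apply: (@ex_covers_trans 1 n _ _ _ _ IH); exact: ex_covers_edge.
Qed.

(** Indices above 2 descend one by one, negative ones climb to [-2], which covers 2, and 1 covers
    [-2]. *)
Lemma ex_covers_to2 m : ex_index m -> exists n, ex_covers n (ex_piece m 1) (ex_piece 2 1).
Proof.
have c0 k : ex_covers 0%N (ex_piece k 1) (ex_piece k 1) by move=> z hz; exists z.
have pos (j : nat) : exists n, ex_covers n (ex_piece (2 + j%:Z) 1) (ex_piece 2 1).
  elim: j => [|j [n IH]]; first by exists 0%N; rewrite addr0.
  exists (1 + n)%N; apply: ex_covers_trans IH; apply: ex_covers_edge.
    by rewrite /ex_index; lia.
  by rewrite /ex_shift; do ! case: eqP; lia.
have neg (j : nat) : exists n, ex_covers n (ex_piece (- 2 - j%:Z) 1) (ex_piece 2 1).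
  elim: j => [|j [n IH]].
    by rewrite subr0; exists 1%N; exact: ex_covers_edge.
  exists (1 + n)%N; apply: ex_covers_trans IH; apply: ex_covers_edge.
    by rewrite /ex_index; lia.
  by rewrite /ex_shift; do ! case: eqP; lia.
move=> im; have [->|m1] := eqVneq m 1.
  have [n h] := neg 0%N; rewrite subr0 in h.
  by exists (1 + n)%N; apply: ex_covers_trans h; exact: ex_covers_edge.
have [h|h] := leP 2 m.
  by have := pos (absz (m - 2)%R); rewrite (_ : 2 + _ = m)//; lia.
by have := neg (absz (- 2 - m)%R); rewrite (_ : - 2 - _ = m)//; move: im; rewrite /ex_index; lia.
Qed.

(** From 2 the larger indices are reached one by one; the negative side is entered through 1, which
    covers [-2] and [-3], and then descended. *)
Lemma ex_covers_from2 m : ex_index m -> exists n, ex_covers n (ex_piece 2 1) (ex_piece m 1).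
Proof.
have pos (j : nat) : exists n, ex_covers n (ex_piece 2 1) (ex_piece (2 + j%:Z) 1).
  elim: j => [|j [n IH]]; first by exists 0%N; rewrite addr0 => z hz; exists z.
  exists (n + 1)%N; apply: (ex_covers_trans IH); apply: ex_covers_edge.
    by rewrite /ex_index; lia.
  by rewrite /ex_shift; do ! case: eqP; lia.
have one : ex_covers 1%N (ex_piece 2 1) (ex_piece 1 1) by exact: ex_covers_edge.
have neg (j : nat) : exists n, ex_covers n (ex_piece 2 1) (ex_piece (- 3 - j%:Z) 1).
  elim: j => [|j [n IH]].
    by rewrite subr0; exists 2%N; apply: (ex_covers_trans one); exact: ex_covers_edge.
  exists (n + 1)%N; apply: (ex_covers_trans IH); apply: ex_covers_edge.
    by rewrite /ex_index; lia.
  by rewrite /ex_shift; do ! case: eqP; lia.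
move=> im; have [->|m1] := eqVneq m 1; first by exists 1%N.
have [->|m2] := eqVneq m (- 2).
  by exists 2%N; apply: (ex_covers_trans one); exact: ex_covers_edge.
have [h|h] := leP 2 m.
  by have := pos (absz (m - 2)%R); rewrite (_ : 2 + _ = m)//; lia.
by have := neg (absz (- 3 - m)%R); rewrite (_ : - 3 - _ = m)//; move: im; rewrite /ex_index; lia.
Qed.

Lemma ex_covers_all m k : ex_index m -> ex_index k ->
  exists N, forall n, (N <= n)%N -> ex_covers n (ex_piece m 1) (ex_piece k 1).
Proof.
move=> /ex_covers_to2[n1 h1] /ex_covers_from2[n2 h2]; exists (n1 + n2)%N => n le.
have -> : n = (n1 + (n - (n1 + n2)) + n2)%N by lia.
by apply: ex_covers_trans h2; apply: (ex_covers_trans h1); exact: ex_covers_loop.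
Qed.

Lemma open_ex_arc (U : set (\bar R)) : open U -> U `&` `[(- 1%:E)%E, 1%:E] !=set0 ->
  exists m p q, [/\ ex_index m, m%:~R <= p, p < q, q <= (m + 1)%:~R &
    ex_arc p q `<=` U `&` `[(- 1%:E)%E, 1%:E]].
Proof.
move=> oU [z [Uz]]; rewrite /= in_itv/=; case: z Uz => [x0| |] Ux /andP[] //.
rewrite -?EFinN !lee_fin => x1 x2.
(* Moves the point off [0] and off the endpoints: [0] is replaced by [del], any other point is
   shrunk by the factor [1 - del]. *)
have [y Uy [y0 y1]] : exists2 y, U y%:E & y != 0 /\ `|y| < 1.
  have : nbhs x0%:E U by apply: open_nbhs_nbhs.
  move=> /nbhs_EFin/nbhs_ballP[e /= e0 re].
  pose del := Num.min e 1 / 2.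
  have d0 : 0 < del by rewrite divr_gt0// lt_min e0 ltr01.
  have de : del < e.
    have : Num.min e 1 <= e by rewrite ge_min lexx.
    by move: d0; rewrite /del; lra.
  have d1 : del <= 1 / 2 by rewrite /del ler_pM2r ?invr_gt0// ge_min lexx orbT.
  have [x00|x00] := eqVneq x0 0.
    exists del; first by apply: re; rewrite /ball/= x00 sub0r normrN gtr0_norm.
    by split; [rewrite gt_eqF|rewrite gtr0_norm//; lra].
  have nx : `|x0| <= 1 by rewrite ler_norml x1.
  have nx0 : 0 < `|x0| by rewrite normr_gt0.
  exists (x0 * (1 - del)).
    by apply: re; rewrite /ball/= (_ : x0 - _ = x0 * del); [rewrite normrM (gtr0_norm d0); nra|lra].
  split; first by rewrite mulf_neq0// gt_eqF//; lra.
  by rewrite normrM (@gtr0_norm _ (1 - del)); [nra|lra].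
have u1 : 1 < `|y^-1| by rewrite normfV invf_gt1// normr_gt0.
have : \forall u \near y^-1, U (u^-1)%:E.
  have : nbhs y%:E U by apply: open_nbhs_nbhs.
  move=> /nbhs_EFin; rewrite -{1}[y]invrK => h.
  have ct : GRing.inv x @[x --> y^-1] --> (y^-1)^-1 := inv_continuous (invr_neq0 y0).
  exact: (ct _ h).
move=> /nbhs_ballP[e /= e0 re].
have [m1 m2] := andP (floor_itv y^-1); set m := Num.floor y^-1 in m1 m2.
have im : ex_index m.
  have [p|p] := leP 0 y^-1.
    have : (1 : int)%:~R < (m + 1)%:~R :> R by move: u1; rewrite ger0_norm//; lra.
    by rewrite ltr_int /ex_index; lia.
  have : m%:~R < (- 1 : int)%:~R :> R.
    by move: u1; rewrite ltr0_norm// mulrN1z; lra.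
  by rewrite ltr_int /ex_index; lia.
(* The arc starts at [1/y], possibly an integer, and extends to the right only, so that it stays in
   the unit interval given by the floor. *)
exists m, y^-1, (Num.min (y^-1 + e) (m + 1)%:~R); split => //.
- by rewrite lt_min m2 andbT; lra.
- by rewrite ge_min lexx orbT.
move=> _ [u + <-]; rewrite /= in_itv/= lt_min => /andP[h1 /andP[h2 h3]]; split.
  by apply: re; rewrite /ball/= distrC gtr0_norm; lra.
have : ex_piece m 1 (u^-1)%:E by apply/ex_pieceP; apply/andP; split; lra.
move=> /(basic_sub ex_partition_left ex_partition_right (ex_piece_basic im)).
by move=> [/ltW_between h _]; rewrite /= in_itv.
Qed.

Lemma ex_mixing : topologically_mixing (- 1%:E)%E 1%:E ex_map.
Proof.
move=> U V oU oV /(open_ex_arc oU)[m [p [q [im mp pq qm Usub]]]].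
move=> /(open_ex_arc oV)[m' [p' [q' [im' mp' pq' qm' Vsub]]]].
have [n hn] := @expr_unbounded (q - p) ltac:(rewrite subr_gt0; exact: pq).
have [N [k [ik cv]]] := ex_arc_grows im mp pq qm hn.
have [N' cv'] := ex_covers_all ik im'.
exists (N + N')%N => n' le.
have cv2 : ex_covers n' (ex_arc p q) (ex_piece m' 1).
  have -> : n' = (N + (n' - N))%N by lia.
  by apply: (ex_covers_trans cv); apply: cv'; lia.
have hw : p' < (p' + q') / 2 < q' by apply/andP; split; lra.
pose z := ((((p' + q') / 2)^-1)%:E : \bar R).
have Vz : ex_arc p' q' z by exists ((p' + q') / 2) => //=; rewrite in_itv.
have [x hx xz] : (iter n' ex_map @` ex_arc p q) z.
  by apply: cv2; apply/ex_pieceP; move: hw => /andP[? ?]; apply/andP; split; lra.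
exists z; split; last exact: Vsub.
by exists x => //; exact: Usub.
Qed.

(** * Absence of an affine coordinate with factor 3 for the example *)

Lemma bounded_third_difference (y : nat -> R) (K : R) : (forall n, y n < y n.+1) ->
  (forall n, y n.+3 - y n = 3 * (y n.+2 - y n.+1)) -> ~ (forall n, y n <= K).
Proof.
move=> inc rec bd.
(* The recurrence says that second differences are constant, so the increments form an arithmetic
   progression of step [e]. *)
pose e := y 2%N - y 1%N - (y 1%N - y 0%N).
have diff n : y n.+1 - y n = (y 1%N - y 0%N) + n%:R * e.
  have H : y n.+1 - y n = (y 1%N - y 0%N) + n%:R * e /\
           y n.+2 - y n.+1 = (y 1%N - y 0%N) + n.+1%:R * e.
    elim: n => [|n [IH1 IH2]]; first by rewrite mul0r mul1r /e; split; lra.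
    split => //; have := rec n.
    have e1 : n.+1%:R = n%:R + 1 :> R by rewrite -addn1 natrD.
    have e2 : n.+2%:R = n%:R + 1 + 1 :> R by rewrite -addn1 natrD e1.
    move: IH1 IH2; rewrite e2 e1 !mulrDl; lra.
  by case: H.
(* A negative step would eventually make an increment negative. Otherwise the increments stay at
   least as large as the first one, and [y] grows at least linearly. *)
have e0 : 0 <= e.
  rewrite leNgt; apply/negP => eneg.
  have [n hn] : exists n : nat, (y 1%N - y 0%N) / - e < n%:R.
    by eexists; exact: truncnS_gt.
  move: hn; rewrite ltr_pdivrMr ?oppr_gt0// mulrN => hn.
  by have := diff n; have := inc n; lra.
have lin n : y 0%N + n%:R * (y 1%N - y 0%N) <= y n.
  elim: n => [|n IH]; first by rewrite mul0r addr0.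
  have := diff n; have := ler0n R n; rewrite -addn1 natrD mulrDl mul1r.
  have : 0 <= n%:R * e by rewrite mulr_ge0// ler0n.
  by move: IH; lra.
have d0 : 0 < y 1%N - y 0%N by rewrite subr_gt0.
have [n] : exists n : nat, (K - y 0%N) / (y 1%N - y 0%N) < n%:R.
  by eexists; exact: truncnS_gt.
by rewrite ltr_pdivrMr// => hn; have := lin n; have := bd n; lra.
Qed.

(** Carries an identity known inside a piece over to its endpoints. *)
Lemma continuous_zero (D : R -> R) p q r : p < q -> p <= r <= q -> {for r, continuous D} ->
  (forall u, p < u < q -> D u = 0) -> D r = 0.
Proof.
move=> pq /andP[pr rq] ct D0; apply/eqP; apply: contrapT => /negP nz.
have /nbhs_ballP[e /= e0 re] : \forall u \near r, D u != 0 by exact: (cvgr_neq0 _ ct nz).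
have [rq'|qr] := ltP r q.
  have /andP[h1 h2] : 0 < Num.min e (q - r) / 2 < Num.min e (q - r).
    have : 0 < Num.min e (q - r) by rewrite lt_min e0 subr_gt0.
    by move=> ?; apply/andP; split; lra.
  move: h2; rewrite lt_min; set w := _ / 2 in h1 * => /andP[h2 h3].
  have := re (r + w); rewrite /ball/= opprD addrA subrr sub0r normrN gtr0_norm// D0 ?eqxx.
    by move=> /(_ h2).
  by apply/andP; split; lra.
have /andP[h1 h2] : 0 < Num.min e (r - p) / 2 < Num.min e (r - p).
  have : 0 < Num.min e (r - p) by rewrite lt_min e0 subr_gt0; lra.
  by move=> ?; apply/andP; split; lra.
move: h2; rewrite lt_min; set w := _ / 2 in h1 * => /andP[h2 h3].
have := re (r - w); rewrite /ball/= opprB addrC subrK gtr0_norm// D0 ?eqxx.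
  by move=> /(_ h2).
by apply/andP; split; lra.
Qed.

Lemma ex_no_affine_coordinate Psi :
  ~ affine_coordinate (- 1%:E)%E 1%:E ex_partition ex_map 3 Psi.
Proof.
suff main F : affine_coordinate (- 1%:E)%E 1%:E ex_partition ex_map 3 F ->
    ~ (forall x y : R, (- 1%:E < x%:E)%E -> (y%:E < 1%:E)%E -> x < y -> F y < F x).
  move=> ac; case: (ac_mono ac) => m; last exact: (main _ ac).
  by apply: (main _ (affine_coordinateN ac)) => x y ax yb xy; rewrite ltrN2; exact: m.
move=> ac dec; pose phi u := F u^-1.
have between u : 1 < u -> (- 1%:E < (u^-1)%:E < 1%:E)%E.
  move=> u1; have : 0 < u^-1 by rewrite invr_gt0; lra.
  by rewrite -EFinN !lte_fin invf_lt1; [move=> h; rewrite u1 andbT; lra|lra].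
have phi_inc u w : 1 < u -> u < w -> phi u < phi w.
  move=> u1 uw; have /andP[_ h1] := between _ u1.
  have /andP[h2 _] := @between w ltac:(lra).
  by apply: dec => //; rewrite ltf_pV2 ?posrE; lra.
have phi_ct u : 1 < u -> {for u, continuous phi}.
  move=> u1; apply: continuous_comp.
    by apply: inv_continuous; rewrite gt_eqF//; lra.
  exact: (ac_continuous ac (between _ u1)).
(* Starting at 2 keeps every argument in [u > 1], where [phi] is known to be continuous and
   increasing. The bound [F 0] is available because [0] is interior and lies below all the points
   [1/u]. *)
apply: (@bounded_third_difference (fun n => phi n.+2%:R) (F 0)).
- move=> n; apply: phi_inc; rewrite ?ltr_nat//.
  by rewrite (ltr_nat R 1).
(* The piece [(n + 3, n + 4)] maps onto [(n + 2, n + 5)]; comparing the endpoints gives the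
   recurrence. *)
- move=> n; pose m : int := n.+3.
  have mE : m%:~R = n%:R + 3 :> R by rewrite /m -pmulrn -addn3 natrD.
  have n0 := ler0n R n.
  have im : ex_index m by rewrite /ex_index /m; lia.
  have sm : (ex_shift m)%:~R = n%:R + 2 :> R.
    have -> : ex_shift m = n.+2%:Z by rewrite /ex_shift /m; do ! case: eqP; lia.
    by rewrite -pmulrn -addn2 natrD.
  have [s [t [sl st]]] := ac_affine ac (ex_piece_basic im).
  (* [D] uses the affine branch of the piece also at [m + 1], where the map itself follows the next
     branch; so [D] is continuous up to both endpoints. *)
  pose D u := phi (3 * (u - m%:~R) + (ex_shift m)%:~R) - (s * phi u + t).
  have D0 u : m%:~R < u < m%:~R + 1 -> D u = 0.
    move=> hu; have hu' : m%:~R < u < (m + 1)%:~R by rewrite intrD.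
    have := st u^-1 (iffRL (ex_pieceP _ _ _) hu').
    by rewrite (ex_map_piece hu') /= /D /phi => ->; rewrite subrr.
  have Dct u : m%:~R <= u -> {for u, continuous D}.
    move=> hu; apply: cvgB.
      have h : {for 3 * (u - m%:~R) + (ex_shift m)%:~R, continuous phi}.
        by apply: phi_ct; lra.
      apply: (continuous_cvg _ h).
      apply: cvgD; last exact: cvg_cst.
      by apply: cvgMr; apply: cvgB; [exact: cvg_id|exact: cvg_cst].
    apply: cvgD; last exact: cvg_cst.
    by apply: cvgMr; apply: phi_ct; lra.
  have D1 : D m%:~R = 0.
    by apply: (@continuous_zero D m%:~R (m%:~R + 1)) => //; [lra|rewrite lexx; lra|exact: Dct].
  have D2 : D (m%:~R + 1) = 0.
    by apply: (@continuous_zero D m%:~R (m%:~R + 1)) => //; [lra|rewrite lexx; lra|apply: Dct; lra].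
  have E0 : n.+2%:R = 3 * (m%:~R - m%:~R) + (ex_shift m)%:~R :> R.
    by rewrite sm -addn2 natrD; lra.
  have E3 : n.+3.+2%:R = 3 * (m%:~R + 1 - m%:~R) + (ex_shift m)%:~R :> R.
    by rewrite sm (_ : n.+3.+2 = (n + 5)%N) ?natrD; [lra|lia].
  have E1 : n.+1.+2%:R = m%:~R :> R by rewrite mE -addn3 natrD.
  move: D1 D2; rewrite /D -E0 -E3 -E1.
  rewrite (_ : n.+3%:R + 1 = n.+4%:R); last by rewrite -[in RHS]addn1 natrD.
  (* The slope [-3] is ruled out by the monotonicity of [phi] at the four integers. *)
  have s3 : s = 3 \/ s = - 3.
    by have [p|p] := leP 0 s; move: sl; [rewrite ger0_norm//; left|rewrite ltr0_norm//; right; lra].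
  have i1 : phi n.+2%:R < phi n.+3%:R by apply: phi_inc; rewrite ?ltr_nat// (ltr_nat R 1).
  have i2 : phi n.+3%:R < phi n.+4%:R by apply: phi_inc; rewrite ?ltr_nat// (ltr_nat R 1).
  have i3 : phi n.+4%:R < phi n.+3.+2%:R by apply: phi_inc; rewrite ?ltr_nat// (ltr_nat R 1).
  by case: s3 => ->; lra.
- move=> n; apply: ltW; apply: dec.
  + by rewrite -EFinN lte_fin; lra.
  + by have /andP[] := @between n.+2%:R ltac:(by rewrite (ltr_nat R 1)).
  + by rewrite invr_gt0 ltr0n.
Qed.

End example.

Theorem theorem3p2 (R : realType) :
  (forall (a b : \bar R) (P : set (\bar R)) (f : \bar R -> \bar R) (lambda : R),
     cpmm_pc a b P f -> topologically_mixing a b f -> 1 < lambda ->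
     conjugate_to_constant_slope a b f lambda ->
     exists v : set (\bar R) -> R, nonneg_eigenvector a b P f lambda v)
  /\
  (exists (a b : \bar R) (P : set (\bar R)) (f : \bar R -> \bar R) (lambda : R),
     [/\ cpmm_pc a b P f, topologically_mixing a b f, 1 < lambda,
         exists v : set (\bar R) -> R, nonneg_eigenvector a b P f lambda v &
         ~ conjugate_to_constant_slope a b f lambda]).
Proof.
split.
  move=> a b P f lambda cf mix lam1 [c [d [Q [g [psi [cg slope conj]]]]]].
  apply: (affine_coordinate_eigenvector cf mix lam1).
  exact: (conj_affine_coordinate cf lam1 cg slope conj).
have lam1 : 1 < 3 :> R by lra.
exists (- 1%:E)%E, 1%:E, (@ex_partition R), (@ex_map R), 3; split => //.
- exact: ex_cpmm.
- exact: ex_mixing.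
- by exists (fun=> 1); exact: ex_eigenvector.
- move=> [c [d [Q [g [psi [cg slope conj]]]]]].
  apply: (@ex_no_affine_coordinate R (real_map psi)).
  exact: (conj_affine_coordinate (@ex_cpmm R) lam1 cg slope conj).
Qed.
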